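(* Let $\Gamma$ be a group generated by a finite symmetric set $S$ and let $H_n\leq\Gamma$ be a sequence of subgroups of finite index with $|\Gamma:H_n|\rightarrow\infty$ such that the Schreier graphs $\mathrm{Sch}(\Gamma/H_n,S)$ are Ramanujan for all $n\geq1$. Then $\Gamma$ is a free group freely generated by $S$, and $\mathrm{Sch}(\Gamma/H_n,S)$ has essentially large girth.
   Context: A subset $S\subseteq\Gamma$ is symmetric if $s\in S$ implies $s^{-1}\in S$. Since $S$ is symmetric, ''freely generated by $S$'' is understood with the generators taken up to inversion, i.e. $\Gamma$ is free on a subset of $S$ containing exactly one element from each pair $\{s,s^{-1}\}\subseteq S$. For a subgroup $H\le\Gamma$, the Schreier graph $\mathrm{Sch}(\Gamma/H,S)$ has vertex set the set of right cosets $\Gamma/H=\{Hg\mid g\in\Gamma\}$, and for each $s\in S$ and each vertex $Hg$ there is an $s$-labeled edge from $Hg$ to $Hgs$ (loops and multiple edges allowed); the $s$-labeled edges are inverses of the $s^{-1}$-labeled edges, and the graph is regarded as a $d$-regular undirected graph with $d=|S|$. The Markov operator $M$ on $\ell^2$ of the vertex set is $(Mf)(x)=\frac1d\sum_{s\in S}f(xs)$. For a finite such graph $G$, $\rho_0(G)$ is the norm of $M$ on $\ell_0^2(G)$, the space of vectors with zero sum. The spectral radius $\rho(T_d)$ of the $d$-regular tree $T_d$ is the norm of the Markov averaging operator on $\ell^2(T_d)$. A finite $d$-regular graph $G$ is Ramanujan if $\rho_0(G)\leq\rho(T_d)$. A sequence of finite graphs $G_n$ has essentially large girth if for every $L$,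 $\lim_{n\to\infty}c_L(G_n)/|G_n|=0$, where $c_L(G_n)$ is the number of cycles of length $L$ in $G_n$ and $|G_n|$ is the number of vertices.
   Formalization: Freeness of Γ is claimed only when S contains no element of order 2; otherwise it fails, e.g. for the infinite dihedral group with S={a,b}, a²=b²=1, H_n=⟨(ab)^n⟩. The essentially-large-girth claim is unrestricted. *)

(* Defs.v *)
From HB Require Import structures.
From mathcomp Require Import all_boot all_order all_algebra finmap.
From mathcomp Require Import all_classical all_reals all_analysis.

Set Implicit Arguments.
Unset Strict Implicit.
Unset Printing Implicit Defensive.

Import Order.TTheory GRing.Theory Num.Theory.

Local Open Scope classical_set_scope.
Local Open Scope ring_scope.

(* A d-regular undirected multigraph, d = #|label|: the darts (oriented edges)
   are the pairs (x, s), from x to step x s, and (step x s, linv s) is the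
   inverse dart of (x, s).  Loops and multiple edges are allowed.  A dart may be
   its own inverse, in which case it is a loop counted once in the degree. *)
Record lgraph := LGraph {
  vertex : choiceType;
  label : finType;
  step : vertex -> label -> vertex;
  linv : label -> label;
  linvK : forall s, linv (linv s) = s;
  stepK : forall x s, step (step x s) (linv s) = x }.

Definition finite_graph (G : lgraph) := finite_set [set: vertex G].

Definition order_graph (G : lgraph) : nat := #|` fset_set [set: vertex G]|.

Definition degree (G : lgraph) : nat := #|label G|.

Section Spectral.
Context (R : realType).

Definition l2norm (V : choiceType) (f : V -> R) : \bar R :=
  sqrte (\esum_(x in [set: V]) (`|f x| ^+ 2)%:E).

Definition markov (G : lgraph) (f : vertex G -> R) : vertex G -> R :=
  fun x => (degree G)%:R^-1 * \sum_(s : label G) f (step x s).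

(* The norm of the restriction of T to {f in l^2(V) | P f}; l2norm f <= 1
   forces f to be square-summable. *)
Definition opnorm (V : choiceType) (P : set (V -> R))
    (T : (V -> R) -> (V -> R)) : \bar R :=
  ereal_sup [set l2norm (T f) | f in [set f | P f /\ (l2norm f <= 1)%E]].

(* The sum below is the honest one only when G is finite. *)
Definition zero_sum (G : lgraph) : set (vertex G -> R) :=
  [set f | \sum_(x \in [set: vertex G]) f x = 0].

Definition rho0 (G : lgraph) : \bar R := opnorm (@zero_sum G) (@markov G).

Definition spectral_radius (G : lgraph) : \bar R := opnorm setT (@markov G).

End Spectral.

(* The d-regular tree, realized as the Cayley graph of the free product of d
   copies of Z/2: its vertices are the words over 'I_d without two equal
   consecutive letters, and the s-neighbour of w is obtained by deleting the
   head of w if it is s, and by adding s in front of w otherwise. *)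
Section Tree.
Context (d : nat).

Definition tree_word (w : seq 'I_d) : bool := sorted (fun s t => s != t) w.

Definition tree_flip (w : seq 'I_d) (s : 'I_d) : seq 'I_d :=
  if w is t :: w' then (if t == s then w' else s :: w) else [:: s].

Lemma tree_flip_word w s : tree_word w -> tree_word (tree_flip w s).
Proof.
case: w => [//|t w] /= ww; case: eqVneq => [_|ts].
  exact: path_sorted ww.
by rewrite /tree_word /= eq_sym ts.
Qed.

Lemma tree_flipK w s : tree_word w -> tree_flip (tree_flip w s) s = w.
Proof.
case: w => [_|t w ww] /=; first by rewrite eqxx.
case: eqVneq => [ts|ts] /=; last by rewrite eqxx.
case: w ww => [|u w] /=; first by rewrite ts.
by rewrite /tree_word /= ts => /andP[su _]; rewrite eq_sym (negbTE su).
Qed.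

Definition tree_vertex : choiceType := {w : seq 'I_d | tree_word w}.

Definition tree_step (w : tree_vertex) (s : 'I_d) : tree_vertex :=
  exist _ (tree_flip (val w) s) (tree_flip_word s (valP w)).

Lemma tree_stepK w s : tree_step (tree_step w s) s = w.
Proof. by apply: val_inj; exact: tree_flipK (valP w). Qed.

Definition regular_tree : lgraph :=
  @LGraph tree_vertex 'I_d tree_step id (fun=> erefl) tree_stepK.

End Tree.

Definition ramanujan (R : realType) (G : lgraph) : Prop :=
  finite_graph G /\ (rho0 R G <= spectral_radius R (regular_tree (degree G)))%E.

(* Cycles are unrooted and unoriented: a cycle is the set of undirected edges of
   a closed path with distinct vertices and distinct undirected edges, so a loop
   is a cycle of length 1 and a double edge gives a cycle of length 2. *)
Section Cycles.
Context (G : lgraph).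

Definition dart : choiceType := (vertex G * label G)%type.

Definition dart_rev (e : dart) : dart := (step e.1 e.2, linv e.2).

Definition edge_of (e : dart) : set dart := [set e; dart_rev e].

Definition simple_cycle (p : seq dart) : Prop :=
  [/\ p != [::],
      cycle (fun e e' : dart => step e.1 e.2 == e'.1) p,
      uniq [seq e.1 | e <- p]
    & uniq [seq edge_of e | e <- p]].

Definition cycles (L : nat) : set (set (set dart)) :=
  [set C | exists p : seq dart,
     [/\ simple_cycle p, size p = L & C = [set edge_of e | e in [set` p]]]].

Definition cycle_count (L : nat) : nat := #|` fset_set (cycles L)|.

End Cycles.

Definition essentially_large_girth (R : realType) (G : nat -> lgraph) : Prop :=
  forall L : nat,
    ((cycle_count (G n) L)%:R / (order_graph (G n))%:R : R) @[n --> \oo] --> 0.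

Section Groups.
Context (Gamma : groupType).
Local Open Scope group_scope.

Definition symmetric_set (S : {fset Gamma}) : Prop :=
  forall s, s \in S -> s^-1 \in S.

Definition is_subgroup (H : set Gamma) : Prop := group_closed (mem H).

Definition generates (S : {fset Gamma}) : Prop :=
  forall H : set Gamma, is_subgroup H -> [set` S] `<=` H -> H = setT.

Definition coset_mul (A : set Gamma) (g : Gamma) : set Gamma :=
  [set a * g | a in A].

Definition right_cosets (H : set Gamma) : set (set Gamma) :=
  range (coset_mul H).

Definition finite_index (H : set Gamma) : Prop := finite_set (right_cosets H).

Definition index_of (H : set Gamma) : nat := #|` fset_set (right_cosets H)|.

Lemma coset_mulM A g h : coset_mul (coset_mul A g) h = coset_mul A (g * h).
Proof.
apply/seteqP; split=> [_ [_ [a Aa <-] <-]|_ [a Aa <-]].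
  by exists a; rewrite // mulgA.
by exists (a * g); [exists a|rewrite mulgA].
Qed.

Lemma coset_mulK A g : coset_mul (coset_mul A g) g^-1 = A.
Proof.
rewrite coset_mulM mulgV; apply/seteqP; split=> [_ [a Aa <-]|a Aa].
  by rewrite mulg1.
by exists a; rewrite // mulg1.
Qed.

Section Schreier.
Context (H : set Gamma) (S : {fset Gamma}) (symS : symmetric_set S).

Definition coset : choiceType := right_cosets H.

Lemma coset_stepP (x : coset) (s : S) :
  coset_mul (val x) (val s) \in right_cosets H.
Proof.
have /set_mem[g _ <-] := valP x.
by apply/mem_set; exists (g * val s); rewrite // coset_mulM.
Qed.

Definition coset_step (x : coset) (s : S) : coset := SigSub (coset_stepP x s).

Definition gen_inv (s : S) : S := [` symS (valP s)]%fset.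

Lemma gen_invK s : gen_inv (gen_inv s) = s.
Proof. by apply: val_inj; rewrite /= invgK. Qed.

Lemma coset_stepK x s : coset_step (coset_step x s) (gen_inv s) = x.
Proof. by apply: val_inj; rewrite /= coset_mulK. Qed.

Definition Schreier : lgraph := LGraph gen_invK coset_stepK.

End Schreier.

(* (x, false) stands for x and (x, true) for x^-1 *)
Definition letter_val (a : Gamma * bool) : Gamma := if a.2 then a.1^-1 else a.1.

Definition reduced_word (X : set Gamma) (w : seq (Gamma * bool)) : Prop :=
  (forall a, a \in w -> X a.1) /\
  sorted (fun a b => ~~ ((a.1 == b.1) && (a.2 != b.2))) w.

Definition free_on (X : set Gamma) : Prop :=
  forall g : Gamma,
    exists! w, reduced_word X w /\ \prod_(a <- w) letter_val a = g.

(* Free generation by a symmetric set, the generators being taken up to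
   inversion. *)
Definition freely_generated (S : {fset Gamma}) : Prop :=
  exists X : set Gamma,
    [/\ X `<=` [set` S],
        forall s, s \in S -> exists! x, X x /\ (x = s \/ x = s^-1)
      & free_on X].

(* Since an element s of order 2 satisfies s = s^-1, it cannot belong to a free
   basis; the identity is deliberately not excluded here. *)
Definition no_involution (S : {fset Gamma}) : Prop :=
  forall s, s \in S -> s * s = 1 -> s = 1.

End Groups.

(* Main.v *)
Require Import Defs.
From HB Require Import structures.
From mathcomp Require Import all_boot all_order all_algebra finmap.
From mathcomp Require Import ring lra zify.
From mathcomp Require Import all_classical all_reals all_analysis.

(** Let d = #|S|.  It suffices that for every non-empty reduced word z in the
    letters S, the proportion of vertices of Sch(Gamma/H_n, S) fixed by z tends
    to 0: a simple cycle of length L is read off a reduced word of length L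
    fixing one of its vertices, and a reduced word that is trivial in Gamma
    fixes every vertex.

    Suppose d >= 3 and that z fixes a proportion >= 1/e of the N vertices.  Count
    the pairs (u, v) of reduced words, |v| <= |u| = n, leading from a common
    vertex to a common vertex.
    - Upper bound.  Non-backtracking walks satisfy the recursion
      A Y_(n+1) = Y_(n+2) + (d - 1) Y_n.  Its conserved energy and the Ramanujan
      bound |A| <= 2 sqrt (d - 1) on zero-sum functions (Schur test on the tree)
      give |Y_n| = O(n (d - 1)^(n/2)) there, so the number of pairs is at most
      N (d - 1)^n times a polynomial in n, for N large.
    - Lower bound.  Choose letters p, q such that p z q and p q are reduced and
      q differs from the first letter of z.  Each passage of u through p z q at
      a place where z is a closed walk can be shortened to p q; the choices are
      independent and give distinct words, so u with X such places has 2^X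
      partners v.  As the uniform measure is stationary, X has mean
      proportional to n, and by Jensen the number of pairs is at least
      N (d - 1)^n times an exponential in n.

    For d <= 2 the claim follows from the connectedness of the graphs: a
    cyclically reduced closed walk visits every vertex, and otherwise z is a
    conjugate of a self-inverse letter, which fixes at most two vertices. *)

Set Implicit Arguments.
Unset Strict Implicit.
Unset Printing Implicit Defensive.

Import Order.TTheory GRing.Theory Num.Theory.

Local Open Scope ring_scope.

(** * Non-backtracking walks *)

Section Words.
Context (L : finType) (inv : L -> L).

Definition nbt (a b : L) : bool := b != inv a.

(** The letter [a] precedes the word and is not part of it. Carrying it along lets a word be cut
    anywhere, with [last a b] before the second part. *)
Fixpoint words (n : nat) (a : L) : seq (seq L) :=
  if n is n'.+1 then
    flatten [seq [seq s :: u | u <- words n' s] | s <- enum L & nbt a s]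
  else [:: [::]].

Lemma big_wordsS (M : nmodType) n a (F : seq L -> M) :
  \sum_(u <- words n.+1 a) F u =
  \sum_(s | nbt a s) \sum_(u <- words n s) F (s :: u).
Proof.
rewrite /= big_flatten big_map big_filter big_enum_cond /=.
by apply: eq_bigr => s _; rewrite big_map.
Qed.

Lemma big_words_cat (M : nmodType) n m a (F : seq L -> M) :
  \sum_(u <- words (n + m) a) F u =
  \sum_(b <- words n a) \sum_(u <- words m (last a b)) F (b ++ u).
Proof.
elim: n a F => [|n IH] a F; first by rewrite big_seq1.
rewrite addSn !big_wordsS; apply: eq_bigr => s _.
exact: (IH s (fun u => F (s :: u))).
Qed.

Lemma mem_words n a u : (u \in words n a) = (size u == n) && path nbt a u.
Proof.
elim: n a u => [|n IH] a [|s u] //=.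
  by apply/flattenP => -[_ /mapP[t _ ->] /mapP[]].
rewrite eqSS; apply/flattenP/idP.
  move=> [_ /mapP[t + ->] /mapP[v vn [-> ->]]].
  by rewrite mem_filter => /andP[-> _]; move: vn; rewrite IH.
move=> /and3P[us as_ su]; exists [seq s :: u | u <- words n s].
  by apply: map_f; rewrite mem_filter as_ mem_enum.
by apply: map_f; rewrite IH us.
Qed.

Lemma words_uniq n a : uniq (words n a).
Proof.
elim: n a => [//|n IH] a /=.
have: uniq [seq s <- enum L | nbt a s] by rewrite filter_uniq ?enum_uniq.
elim: [seq s <- enum L | nbt a s] => [//|s l IHl] /= /andP[sl ul].
rewrite cat_uniq map_inj_uniq ?IH ?IHl//=; last by move=> ? ? [].
rewrite andbT; apply/hasPn => _ /flattenP[_ /mapP[t tl ->] /mapP[v _ ->]].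
by apply/mapP => -[w _ [ts _]]; rewrite -ts tl in sl.
Qed.

Hypothesis invK : involutive inv.

Lemma card_nbtl s : #|[pred a | nbt a s]| = #|L|.-1.
Proof.
rewrite -(cardC1 (inv s)); apply: eq_card => a; rewrite !inE /nbt.
by rewrite -(inj_eq (can_inj invK)) invK eq_sym.
Qed.

Lemma sum_nbt (M : nmodType) (g : L -> M) :
  \sum_a \sum_(s | nbt a s) g s = (\sum_s g s) *+ #|L|.-1.
Proof.
rewrite (exchange_big_dep predT)//= -sumrMnl; apply: eq_bigr => s _.
by rewrite sumr_const card_nbtl.
Qed.

(** The uniform measure on letters is stationary, because every letter has exactly [#|L|.-1]
    admissible predecessors. *)
Lemma sum_words_last (M : nmodType) n (g : L -> M) :
  \sum_a \sum_(b <- words n a) g (last a b) = (\sum_s g s) *+ (#|L|.-1 ^ n).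
Proof.
elim: n => [|n IH].
  by rewrite expn0 mulr1n; apply: eq_bigr => a _; rewrite big_seq1.
under eq_bigr => a _ do rewrite big_wordsS /=.
by rewrite sum_nbt IH -mulrnA expnSr.
Qed.

Lemma card_nbt a : #|[pred s | nbt a s]| = #|L|.-1.
Proof. exact: cardC1. Qed.

Lemma size_words n a : size (words n a) = (#|L|.-1 ^ n)%N.
Proof.
elim: n a => [//|n IH] a; rewrite -sum1_size big_wordsS.
under eq_bigr do rewrite sum1_size IH.
by rewrite sum_nat_const card_nbt expnS.
Qed.

Lemma sum_words1 (R : nzRingType) n :
  \sum_a \sum_(b <- words n a) (1 : R) = #|L|%:R * #|L|.-1%:R ^+ n.
Proof.
by rewrite (sum_words_last n (fun=> 1 : R)) sumr_const -mulrnA natrM natrX.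
Qed.

End Words.

(** * Adjacency operator and non-backtracking walks on a finite graph *)

Section Action.
Context (L V : finType) (inv : L -> L) (step : V -> L -> V).
Hypothesis invK : involutive inv.
Hypothesis stepK : forall x s, step (step x s) (inv s) = x.

Local Notation words := (words inv).
Local Notation nbt := (nbt inv).

Definition walk (x : V) (u : seq L) : V := foldl step x u.

Lemma step_inj s : injective (step^~ s).
Proof. exact: (can_inj (g := step^~ (inv s)) (stepK^~ s)). Qed.

Lemma walk_inj u : injective (walk^~ u).
Proof.
elim: u => [//|s u IH] x y /IH; exact: step_inj.
Qed.

Lemma sum_step (M : nmodType) s (f : V -> M) :
  \sum_x f (step x s) = \sum_x f x.
Proof. by rewrite [RHS](reindex_inj (@step_inj s)). Qed.

Lemma sum_walk (M : nmodType) u (f : V -> M) :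
  \sum_x f (walk x u) = \sum_x f x.
Proof. by rewrite [RHS](reindex_inj (@walk_inj u)). Qed.

Section Spectral.
Context (R : realFieldType).

Definition adj (f : V -> R) (x : V) : R := \sum_s f (step x s).

Definition ip (f g : V -> R) : R := \sum_x f x * g x.

Lemma adj_sym f g : ip (adj f) g = ip f (adj g).
Proof.
rewrite /ip /adj; under eq_bigr do rewrite mulr_suml.
under [RHS]eq_bigr do rewrite mulr_sumr.
rewrite exchange_big [RHS]exchange_big /= [RHS](reindex_inj (can_inj invK)).
apply: eq_bigr => s _; rewrite -[RHS](sum_step s); apply: eq_bigr => x _.
by rewrite stepK.
Qed.

(* [nbwalk n f] sums [f] over all non-backtracking walks of length [n], each
   counted once for every admissible preceding letter.  This multiplicity is
   [#|L| - 1], except [#|L|] at [n = 0], and makes the recursion uniform. *)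
Definition nbsum n a (f : V -> R) x : R := \sum_(u <- words n a) f (walk x u).

Definition nbwalk n (f : V -> R) x : R := \sum_a nbsum n a f x.

Local Notation d := (#|L|%:R : R).
Local Notation c := (#|L|.-1%:R : R).

Lemma nbsumS n a f x :
  nbsum n.+1 a f x = \sum_(s | nbt a s) nbsum n s f (step x s).
Proof. exact: big_wordsS. Qed.

Lemma nbwalk0 f x : nbwalk 0 f x = d * f x.
Proof.
rewrite /nbwalk (eq_bigr (fun=> f x)) ?sumr_const ?mulr_natl// => a _.
by rewrite /nbsum big_seq1.
Qed.

Lemma nbwalkS n f x :
  nbwalk n.+1 f x = c * \sum_s nbsum n s f (step x s).
Proof.
rewrite /nbwalk; under eq_bigr do rewrite nbsumS.
by rewrite (sum_nbt invK (fun s => nbsum n s f (step x s))) mulr_natl.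
Qed.

Lemma nbwalk1 f x : nbwalk 1 f x = c * adj f x.
Proof.
rewrite nbwalkS; congr (_ * _); apply: eq_bigr => s _.
by rewrite /nbsum big_seq1.
Qed.

(** After a step [s], the walk either starts with [inv s], returning to [x], or prolongs the step
    without backtracking. *)
Lemma adj_nbwalk n f x :
  adj (nbwalk n.+1 f) x = nbwalk n.+2 f x + c * nbwalk n f x.
Proof.
rewrite /adj; under eq_bigr do rewrite nbwalkS.
rewrite -mulr_sumr nbwalkS -mulrDr; congr (_ * _).
under eq_bigr => s _ do rewrite (bigD1 (inv s))//= -nbsumS stepK.
rewrite big_split /= addrC; congr (_ + _).
by rewrite [RHS](reindex_inj (can_inj invK)).
Qed.

Lemma sum_nbwalk n f : \sum_x nbwalk n f x = d * c ^+ n * \sum_x f x.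
Proof.
rewrite /nbwalk exchange_big /= -(sum_words1 invK) mulr_suml.
apply: eq_bigr => a _; rewrite /nbsum exchange_big /= mulr_suml.
by apply: eq_bigr => u _; rewrite sum_walk mul1r.
Qed.

(** The quadratic invariant of the recursion [adj_nbwalk], up to a factor [c] per step. *)
Definition energy n f : R :=
  ip (nbwalk n.+1 f) (nbwalk n.+1 f) - ip (adj (nbwalk n f)) (nbwalk n.+1 f)
  + c * ip (nbwalk n f) (nbwalk n f).

Lemma energyS n f : energy n.+1 f = c * energy n f.
Proof.
have E : ip (adj (nbwalk n.+1 f)) (nbwalk n.+2 f)
       = ip (nbwalk n.+2 f) (nbwalk n.+2 f) + c * ip (nbwalk n f) (nbwalk n.+2 f).
  rewrite /ip mulr_sumr -big_split; apply: eq_bigr => x _.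
  by rewrite adj_nbwalk /=; ring.
have E' : ip (adj (nbwalk n f)) (nbwalk n.+1 f)
        = ip (nbwalk n f) (nbwalk n.+2 f) + c * ip (nbwalk n f) (nbwalk n f).
  rewrite adj_sym /ip mulr_sumr -big_split; apply: eq_bigr => x _.
  by rewrite adj_nbwalk /=; ring.
by rewrite /energy E E'; ring.
Qed.

Lemma energyE n f : energy n f = c ^+ n * energy 0 f.
Proof.
elim: n => [|n IH]; first by rewrite expr0 mul1r.
by rewrite energyS IH exprS mulrA.
Qed.

Lemma ip_ge0 f : 0 <= ip f f.
Proof. by apply: sumr_ge0 => x _; rewrite -expr2 sqr_ge0. Qed.

(** Since [nbwalk 0] is multiplication by [d], [nbwalk 1] is [c] times [adj], and [d = c + 1], the
    energy equals [c d^2 |f|^2 - c |adj f|^2]. *)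
Lemma energy0_le f : (0 < #|L|)%N -> energy 0 f <= c * d ^+ 2 * ip f f.
Proof.
move=> L0; have -> : energy 0 f = c * d ^+ 2 * ip f f - c * ip (adj f) (adj f).
  have dc : d = c + 1 by rewrite natr1 prednK.
  rewrite /energy /ip 2!mulr_sumr -sumrB -!big_split /= mulr_sumr -sumrB.
  apply: eq_bigr => x _; rewrite !nbwalk0 !nbwalk1.
  have -> : adj (nbwalk 0 f) x = d * adj f x.
    by rewrite /adj mulr_sumr; apply: eq_bigr => s _; rewrite nbwalk0.
  by rewrite dc; ring.
by rewrite gerBl mulr_ge0 ?ip_ge0.
Qed.

(** The bound [2 sqrt c] on zero-sum functions, squared because [R] need not have square roots. *)
Hypothesis normA : forall f, \sum_x f x = 0 ->
  ip (adj f) (adj f) <= 4 * c * ip f f.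

(** The energy bounds the distance of each term from half of [adj] of the previous one, so the norm,
    rescaled by [c^(n/2)], grows by at most [d |f|] per step. *)
Lemma nbwalk_norm n f : (0 < #|L|)%N -> \sum_x f x = 0 ->
  ip (nbwalk n f) (nbwalk n f) <= c ^+ n * (d * n.+1%:R) ^+ 2 * ip f f.
Proof.
move=> L0 f0; elim: n => [|n IH].
  rewrite expr0 mul1r mulr1 /ip mulr_sumr; apply: ler_sum => x _.
  by rewrite nbwalk0 le_eqVlt; apply/orP; left; apply/eqP; ring.
set F := ip f f in IH *; set g := nbwalk n f in IH *; set h := nbwalk n.+1 f.
have g0 : \sum_x g x = 0 by rewrite sum_nbwalk f0 mulr0.
have cn0 : 0 <= c ^+ n by rewrite exprn_ge0.
have n0 : (0 : R) < n.+1%:R by rewrite ltr0n.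
have -> : (n.+2%:R : R) = n.+1%:R + 1 by rewrite natr1.
move: (n.+1%:R : R) n0 IH => k k0 IH; have kN0 := lt0r_neq0 k0.
(* Completing the square in the energy; [normA] makes the remaining terms
   nonnegative. *)
have Hdiff : ip (fun x => h x - adj g x / 2) (fun x => h x - adj g x / 2)
    <= c ^+ n * (c * d ^+ 2 * F).
  apply: le_trans (_ : energy n f <= _); last first.
    by rewrite energyE ler_wpM2l// energy0_le.
  have -> : energy n f =
      ip (fun x => h x - adj g x / 2) (fun x => h x - adj g x / 2)
      + (c * ip g g - ip (adj g) (adj g) / 4).
    rewrite /energy -/g -/h /ip !mulr_sumr mulr_suml -!sumrB -!big_split /=.
    by apply: eq_bigr => x _; field.
  by rewrite lerDl; have := normA g0; lra.
(* This is [(a + b)^2 <= (1 + 1/k) a^2 + (k + 1) b^2]. The weight [k = n + 1] makes the two bounds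
   add up exactly: [(1 + 1/k) k^2 + (k + 1) = (k + 1)^2]. *)
have Hsq : ip h h <= (1 + k^-1) * (ip (adj g) (adj g) / 4)
   + (k + 1) * ip (fun x => h x - adj g x / 2) (fun x => h x - adj g x / 2).
  rewrite /ip mulr_suml !mulr_sumr -big_split; apply: ler_sum => x _ /=.
  set a := adj g x; rewrite -subr_ge0.
  have -> : (1 + k^-1) * (a * a / 4) +
     (k + 1) * ((h x - a / 2) * (h x - a / 2)) - h x * h x =
     k * (h x - a / 2 - a / 2 / k) ^+ 2.
    by field.
  by rewrite mulr_ge0 ?sqr_ge0// ltW.
apply: le_trans Hsq _.
have -> : c ^+ n.+1 * (d * (k + 1)) ^+ 2 * F =
   (1 + k^-1) * (c * (c ^+ n * (d * k) ^+ 2 * F))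
   + (k + 1) * (c ^+ n * (c * d ^+ 2 * F)).
  by rewrite exprS; field.
apply: lerD; last by rewrite ler_wpM2l// addr_ge0// ltW.
rewrite ler_wpM2l//; first by rewrite addr_ge0// invr_ge0 ltW.
have := normA g0; have : c * ip g g <= c * (c ^+ n * (d * k) ^+ 2 * F).
  by rewrite ler_wpM2l.
lra.
Qed.

Definition delta (y x : V) : R := (x == y)%:R.

Lemma sum_delta y : \sum_x delta y x = 1.
Proof.
by rewrite (bigD1 y)//= /delta eqxx big1 ?addr0// => x /negbTE ->.
Qed.

Lemma nbwalkD n f g x :
  nbwalk n (fun y => f y + g y) x = nbwalk n f x + nbwalk n g x.
Proof.
rewrite /nbwalk -big_split; apply: eq_bigr => a _.
by rewrite /nbsum big_split.
Qed.

Lemma nbwalk_cst n k x : nbwalk n (fun=> k) x = d * c ^+ n * k.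
Proof.
rewrite /nbwalk -(sum_words1 invK) mulr_suml; apply: eq_bigr => a _.
by rewrite /nbsum mulr_suml; apply: eq_bigr => u _; rewrite mul1r.
Qed.

Lemma nbwalk_delta n y x : (0 < #|V|)%N ->
  nbwalk n (delta y) x =
  nbwalk n (fun z => delta y z - #|V|%:R^-1) x + d * c ^+ n / #|V|%:R.
Proof.
move=> V0; rewrite -(nbwalk_cst n _ x) -nbwalkD; apply: eq_bigr => a _.
by apply: eq_bigr => u _; rewrite subrK.
Qed.

Lemma nbwalk_norm_le n m f : (1 < #|L|)%N -> (m <= n)%N ->
  \sum_x f x = 0 -> ip f f <= 1 ->
  ip (nbwalk m f) (nbwalk m f) <= c ^+ n * (d * n.+1%:R) ^+ 2.
Proof.
move=> L1 mn f0 f1; have c1 : 1 <= c by rewrite ler1n; case: #|L| L1 => [|[]].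
apply: le_trans (nbwalk_norm m (ltnW L1) f0) _.
apply: le_trans (ler_wpM2l _ f1) _; rewrite ?mulr1.
  by rewrite mulr_ge0 ?exprn_ge0 ?mulr_ge0.
rewrite ler_pM ?exprn_ge0 ?mulr_ge0// ?ler_weXn2l//.
by rewrite lerXn2r ?nnegrE ?mulr_ge0// ler_wpM2l// ler_nat.
Qed.

(** [delta y] is the constant [1 / #|V|] plus a zero-sum function of norm at most 1. The zero-sum
    parts give the first term, the constants the second. *)
Lemma pair_delta_le n m : (1 < #|L|)%N -> (0 < #|V|)%N -> (m <= n)%N ->
  \sum_y ip (nbwalk n (delta y)) (nbwalk m (delta y)) <=
  #|V|%:R * (c ^+ n * (d * n.+1%:R) ^+ 2) + (d * c ^+ n) ^+ 2.
Proof.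
move=> L1 V0 mn; have VN : #|V|%:R != 0 :> R by rewrite pnatr_eq0 -lt0n.
have c1 : 1 <= c by rewrite ler1n; case: #|L| L1 => [|[]].
have D0 k : 0 <= d * c ^+ k by rewrite mulr_ge0 ?exprn_ge0.
have -> : #|V|%:R * (c ^+ n * (d * n.+1%:R) ^+ 2) + (d * c ^+ n) ^+ 2 =
    \sum_(y : V) (c ^+ n * (d * n.+1%:R) ^+ 2 + (d * c ^+ n) ^+ 2 / #|V|%:R).
  by rewrite sumr_const -[_ *+ #|_|]mulr_natl; field.
apply: ler_sum => y _; set f := fun z => delta y z - #|V|%:R^-1.
have f0 : \sum_x f x = 0.
  by rewrite sumrB sum_delta sumr_const -[_^-1 *+ _]mulr_natl mulfV ?subrr.
have f1 : ip f f <= 1.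
  have -> : ip f f = \sum_x (delta y x - 2 * #|V|%:R^-1 * delta y x + #|V|%:R^-1 ^+ 2).
    apply: eq_bigr => x _; rewrite /f /delta; case: eqP => _ /=; ring.
  rewrite big_split sumrB -mulr_sumr sum_delta sumr_const /= -[_ ^+ 2 *+ _]mulr_natl.
  have -> : 1 - 2 * #|V|%:R^-1 * 1 + #|V|%:R * #|V|%:R^-1 ^+ 2 = 1 - #|V|%:R^-1 :> R.
    by field.
  by rewrite gerBl invr_ge0.
(* The mixed terms vanish, since [nbwalk] maps constants to constants and zero-sum functions to
   zero-sum functions. *)
have -> : ip (nbwalk n (delta y)) (nbwalk m (delta y)) =
    ip (nbwalk n f) (nbwalk m f) + (d * c ^+ n) * (d * c ^+ m) / #|V|%:R.
  rewrite /ip; under eq_bigr do rewrite !nbwalk_delta// -/f mulrDl !mulrDr.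
  rewrite !big_split /= -!mulr_suml -!mulr_sumr !sum_nbwalk f0 sumr_const.
  by rewrite -[_ *+ #|_|]mulr_natl; field.
apply: lerD; last first.
  rewrite ler_wpM2r ?invr_ge0// expr2 ler_wpM2l// ler_wpM2l//.
  exact: ler_weXn2l.
have Hn := nbwalk_norm_le L1 (leqnn n) f0 f1.
have Hm := nbwalk_norm_le L1 mn f0 f1.
apply: le_trans
  (_ : (ip (nbwalk n f) (nbwalk n f) + ip (nbwalk m f) (nbwalk m f)) / 2 <= _).
  rewrite /ip -big_split mulr_suml; apply: ler_sum => x _ /=.
  by have := sqr_ge0 (nbwalk n f x - nbwalk m f x); lra.
by lra.
Qed.

Lemma sum_nbwalk_delta n (g : V -> R) x :
  \sum_y nbwalk n (delta y) x * g y = nbwalk n g x.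
Proof.
under eq_bigr do rewrite /nbwalk mulr_suml.
rewrite exchange_big; apply: eq_bigr => a _ /=.
under eq_bigr do rewrite /nbsum mulr_suml.
rewrite exchange_big; apply: eq_bigr => u _ /=.
rewrite (bigD1 (walk x u))//= /delta eqxx mul1r big1 ?addr0// => y.
by rewrite eq_sym => /negbTE->; rewrite mul0r.
Qed.

(** The inner product at [y] counts, with multiplicities, the pairs of reduced walks of lengths [n]
    and [m] from a common vertex to [y]; [P x u] lists some partners of [u]. *)
Lemma count_pairs n (P : V -> seq L -> seq (seq L)) :
  (1 < #|L|)%N -> (0 < #|V|)%N ->
  (forall x u, uniq (P x u)) ->
  (forall x a u v, u \in words n a -> v \in P x u ->
     [/\ (size v <= n)%N, path nbt a v & walk x v = walk x u]) ->
  \sum_x \sum_a \sum_(u <- words n a) (size (P x u))%:R <=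
  n.+1%:R * (#|V|%:R * (c ^+ n * (d * n.+1%:R) ^+ 2) + (d * c ^+ n) ^+ 2).
Proof.
move=> L1 V0 Pu Pv.
apply: le_trans (_ : \sum_(m < n.+1) \sum_y ip (nbwalk n (delta y)) (nbwalk m (delta y)) <= _);
  last first.
  rewrite mulr_natl -[X in _ *+ X]card_ord -sumr_const; apply: ler_sum => m _.
  by rewrite pair_delta_le// -ltnS.
have -> : \sum_(m < n.+1) \sum_y ip (nbwalk n (delta y)) (nbwalk m (delta y)) =
    \sum_x \sum_a \sum_(u <- words n a)
      \sum_(m < n.+1) nbwalk m (delta (walk x u)) x.
  under eq_bigr => m _.
    rewrite /ip exchange_big /=.
    under eq_bigr => x _ do
      rewrite (sum_nbwalk_delta n (fun y => nbwalk m (delta y) x)).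
    over.
  rewrite exchange_big /=; apply: eq_bigr => x _.
  rewrite exchange_big /=; apply: eq_bigr => a _.
  by rewrite exchange_big.
apply: ler_sum => x _; apply: ler_sum => a _.
rewrite big_seq [leRHS]big_seq; apply: ler_sum => u un.
(* All words of length at most [n], after any letter. The partners of [u] are distinct and occur
   among those with the same end point as [u]. *)
pose allw := flatten [seq flatten [seq words m b | b <- enum L] | m <- iota 0 n.+1].
have -> : \sum_(m < n.+1) nbwalk m (delta (walk x u)) x =
    (count (fun v => walk x v == walk x u) allw)%:R.
  rewrite -sum1_count natr_sum /allw big_flatten big_map -[iota 0 n.+1]val_enum_ord.
  rewrite big_map big_enum /=; apply: eq_bigr => m _.
  rewrite /nbwalk big_flatten big_map big_enum; apply: eq_bigr => b _.
  by rewrite /nbsum big_mkcond; apply: eq_bigr => v _; rewrite /delta; case: eqP.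
rewrite ler_nat -size_filter; apply: uniq_leq_size => // v vP.
have [vn av xv] := Pv _ _ _ _ un vP.
rewrite mem_filter xv eqxx; apply/flattenP.
exists (flatten [seq words (size v) b | b <- enum L]).
  by apply/mapP; exists (size v); rewrite ?mem_iota.
apply/flattenP; exists (words (size v) a).
  by apply/mapP; exists a; rewrite ?mem_enum.
by rewrite mem_words eqxx.
Qed.

End Spectral.
End Action.

(** * Substitutions along a walk *)

Section Substitution.
Context (L V : finType) (inv : L -> L) (step : V -> L -> V).
Hypothesis invK : involutive inv.
Hypothesis stepK : forall x s, step (step x s) (inv s) = x.

Local Notation words := (words inv).
Local Notation nbt := (nbt inv).
Local Notation walk := (walk step).

Lemma walk_cat x u v : walk x (u ++ v) = walk (walk x u) v.
Proof. exact: foldl_cat. Qed.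

Context (B : pred V) (l1 l2 : seq L).

Definition is_site (x : V) (b : seq L) : bool := (b == l1) && B x.

(** [u] is read in [k] consecutive blocks of the length of [l1]. Only whole blocks are replaced, so
    the choices do not interfere. *)
Fixpoint variants (k : nat) (x : V) (u : seq L) : seq (seq L) :=
  if k is k'.+1 then
    let b := take (size l1) u in
    let vs := variants k' (walk x b) (drop (size l1) u) in
    if is_site x b then map (cat l1) vs ++ map (cat l2) vs else map (cat b) vs
  else [:: u].

Fixpoint sites (k : nat) (x : V) (u : seq L) : nat :=
  if k is k'.+1 then
    let b := take (size l1) u in
    (is_site x b + sites k' (walk x b) (drop (size l1) u))%N
  else 0%N.

Lemma size_variants k x u : size (variants k x u) = (2 ^ sites k x u)%N.
Proof.
elim: k x u => [//|k IH] x u /=; case: is_site.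
  by rewrite size_cat !size_map !IH addnn expnS mul2n.
by rewrite size_map IH.
Qed.

Hypothesis l1_l2 : forall u v, l1 ++ u != l2 ++ v.

(** Neither of [l1], [l2] is a prefix of the other, so the choices can be read off the word from
    left to right. *)
Lemma variants_uniq k x u : uniq (variants k x u).
Proof.
have catI (b : seq L) : injective (cat b).
  by move=> v w /eqP; rewrite eqseq_cat// eqxx => /eqP.
elim: k x u => [//|k IH] x u /=; case: is_site; last by rewrite map_inj_uniq.
rewrite cat_uniq !map_inj_uniq// !IH /= andbT; apply/hasPn => _ /mapP[v _ ->].
by apply/mapP => -[w _ /eqP]; rewrite eq_sym (negbTE (l1_l2 _ _)).
Qed.

Hypothesis walkB : forall x, B x -> walk x l1 = walk x l2.
Hypothesis size_l2 : (size l2 <= size l1)%N.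
Hypothesis last_l2 : forall a, last a l1 = last a l2.
Hypothesis path_l2 : forall a, path nbt a l1 -> path nbt a l2.

(** A replaced block keeps its end point by [walkB] and fits its neighbours by [path_l2] and
    [last_l2]. *)
Lemma variantsP k x a u v : path nbt a u -> v \in variants k x u ->
  [/\ (size v <= size u)%N, path nbt a v & walk x v = walk x u].
Proof.
elim: k x a u v => [|k IH] x a u v au /=; first by rewrite inE => /eqP ->.
have eu := cat_take_drop (size l1) u.
set b := take _ u in eu *; set u' := drop _ u in eu *.
move: au; rewrite -eu cat_path size_cat => /andP[ab bu'].
have [/andP[/eqP bl1 Bx]|_] := boolP (is_site x b).
  rewrite mem_cat bl1 in ab bu' *.
  move=> /orP[] /mapP[w /(IH _ _ _ _ bu')[sw pw ww] ->];
    rewrite size_cat cat_path !walk_cat.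
    by rewrite ab pw leq_add2l ww.
  by rewrite path_l2// -last_l2 pw leq_add// -walkB// ww.
move=> /mapP[w /(IH _ _ _ _ bu')[sw pw ww] ->].
by rewrite size_cat cat_path !walk_cat ab pw leq_add2l ww.
Qed.

Section Count.
Context (R : realFieldType).
Local Notation d := (#|L|%:R : R).
Local Notation c := (#|L|.-1%:R : R).
Local Notation K := (size l1).

Hypothesis l1N : l1 != [::].
Hypothesis l1_sorted : sorted nbt l1.

Definition total_sites k : R :=
  \sum_x \sum_a \sum_(u <- words (K * k) a) (sites k x u)%:R.

Lemma sum_words_l1 : \sum_a \sum_(b <- words K a) ((b == l1)%:R : R) = c.
Proof.
have [s [l E]] : exists s l, l1 = s :: l by case: (l1) l1N => [//|s l]; exists s, l.
have path_l1 a : path nbt a l1 = nbt a s.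
  by move: l1_sorted; rewrite E /= => ->; rewrite andbT.
rewrite -(card_nbtl invK s) -sumr_const [RHS]big_mkcond; apply: eq_bigr => a _.
rewrite inE; have [as_|as_] := boolP (nbt a s).
  rewrite (bigD1_seq l1) ?words_uniq ?mem_words ?eqxx ?path_l1//=.
  by rewrite big1 ?addr0// => b /negbTE->.
rewrite big_seq big1// => b; rewrite mem_words => /andP[_].
by case: eqP => // ->; rewrite path_l1 (negbTE as_).
Qed.

(** After the first block, vertex and last letter are again equidistributed: a word permutes the
    vertices, and every letter ends equally many blocks. *)
Lemma total_sitesS k :
  total_sites k.+1 = #|B|%:R * c * c ^+ (K * k) + c ^+ K * total_sites k.
Proof.
rewrite /total_sites.
have split x a : \sum_(u <- words (K * k.+1) a) ((sites k.+1 x u)%:R : R) =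
    \sum_(b <- words K a) ((b == l1)%:R * (B x)%:R * c ^+ (K * k) +
      \sum_(u <- words (K * k) (last a b)) (sites k (walk x b) u)%:R).
  rewrite mulnS big_words_cat big_seq [RHS]big_seq; apply: eq_bigr => b.
  rewrite mem_words => /andP[/eqP sb _].
  rewrite -natrX -(size_words inv (K * k) (last a b)).
  rewrite -(sum1_size (words (K * k) (last a b))) natr_sum.
  rewrite mulr_sumr -big_split; apply: eq_bigr => u _ /=.
  rewrite take_size_cat// drop_size_cat// natrD mulr1 /is_site.
  by case: eqP; case: (B x); rewrite /= ?mul0r ?mul1r ?mulr0.
under eq_bigr => x _ do under eq_bigr => a _ do rewrite split big_split /=.
under eq_bigr => x _ do rewrite big_split /=.
rewrite big_split /=; congr (_ + _).
  have -> : #|B|%:R = \sum_x (B x)%:R :> R.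
    rewrite -sum1_card natr_sum big_mkcond; apply: eq_bigr => x _ /=.
    by rewrite -topredE /=; case: (B x).
  rewrite -mulrA mulr_suml; apply: eq_bigr => x _; rewrite -sum_words_l1.
  rewrite mulr_suml mulr_sumr; apply: eq_bigr => a _.
  by rewrite mulr_suml mulr_sumr; apply: eq_bigr => b _; ring.
rewrite [RHS]mulrC [X in _ = X * _]exchange_big /= -natrX mulr_natr.
rewrite -(sum_words_last invK) exchange_big; apply: eq_bigr => a _ /=.
rewrite exchange_big; apply: eq_bigr => b _ /=.
by rewrite (sum_walk stepK b (fun y =>
  \sum_(u <- words (K * k) (last a b)) (sites k y u)%:R)).
Qed.

Lemma total_sitesE k :
  c ^+ K * total_sites k = k%:R * #|B|%:R * c * c ^+ (K * k).
Proof.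
elim: k => [|k IH].
  rewrite /total_sites big1 ?mulr0 ?mul0r// => x _; rewrite big1// => a _.
  by rewrite big1.
by rewrite total_sitesS mulrDr IH mulnS exprD -natr1; ring.
Qed.

Hypothesis normA : forall f : V -> R, \sum_x f x = 0 ->
  ip (adj step f) (adj step f) <= 4 * c * ip f f.

(* Bernoulli's inequality [2 ^ j >= 1 + j], at [j = i - m], plays the role of
   Jensen's inequality. *)
Lemma exp2_ge_tangent m i : (2 ^+ m * (1 + i%:R - m%:R) : R) <= 2 ^+ i.
Proof.
have [mi|im] := leqP m i.
  rewrite -(subnK mi) natrD addrA addrK exprD mulrC ler_wpM2r ?exprn_ge0//.
  by rewrite addrC natr1 -natrX ler_nat ltn_expl.
apply: (@le_trans _ _ 0); last exact: exprn_ge0.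
have : (i.+1%:R : R) <= m%:R by rewrite ler_nat.
by rewrite -natr1 => ?; rewrite mulr_ge0_le0 ?exprn_ge0//; lra.
Qed.

(** The numerical hypothesis says that the mean number of sites is at least [m]. By the tangent
    bound, the mean of [2 ^ sites], the number of variants, is then at least [2 ^ m]. *)
Lemma many_sites_bound k m : (1 < #|L|)%N -> (0 < #|V|)%N ->
  (m * #|L| * #|L|.-1 ^ K * #|V| <= k * #|B| * #|L|.-1)%N ->
  2 ^+ m * (d * c ^+ (K * k) * #|V|%:R) <=
  (K * k).+1%:R * (#|V|%:R * (c ^+ (K * k) * (d * (K * k).+1%:R) ^+ 2)
    + (d * c ^+ (K * k)) ^+ 2).
Proof.
move=> L1 V0 mk.
have c0 : 0 < c by rewrite ltr0n; case: #|L| L1 => [|[]].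
apply: le_trans (count_pairs invK stepK normA (n := K * k) (P := variants k) _ _ _ _) => //.
- apply: le_trans (_ : 2 ^+ m *
    ((1 - m%:R) * (d * c ^+ (K * k) * #|V|%:R) + total_sites k) <= _).
    rewrite ler_wpM2l ?exprn_ge0// mulrBl mul1r -addrA lerDl addrC subr_ge0.
    rewrite -(ler_pM2l (exprn_gt0 K c0)) total_sitesE.
    have := mk; rewrite -(ler_nat R) !natrM natrX => {}mk.
    rewrite [leRHS]mulrC.
    have -> : c ^+ K * (m%:R * (d * c ^+ (K * k) * #|V|%:R)) =
       c ^+ (K * k) * (m%:R * d * c ^+ K * #|V|%:R) by ring.
    by rewrite ler_wpM2l// exprn_ge0.
  have -> : (1 - m%:R) * (d * c ^+ (K * k) * #|V|%:R) =
     \sum_(x : V) \sum_a \sum_(u <- words (K * k) a) (1 - m%:R).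
    rewrite sumr_const -(sum_words1 invK) -[RHS]mulr_natr mulrA; congr (_ * _).
    rewrite mulr_sumr; apply: eq_bigr => a _; rewrite mulr_sumr.
    by apply: eq_bigr => *; rewrite mulr1.
  rewrite -big_split mulr_sumr; apply: ler_sum => x _ /=.
  rewrite -big_split mulr_sumr; apply: ler_sum => a _ /=.
  rewrite -big_split mulr_sumr; apply: ler_sum => u _ /=.
  rewrite size_variants natrX; apply: le_trans (exp2_ge_tangent m _).
  by rewrite ler_wpM2l ?exprn_ge0//; lra.
- by move=> x u; exact: variants_uniq.
- move=> x a u v; rewrite mem_words => /andP[/eqP <- au] /(variantsP au).
  by [].
Qed.

End Count.
End Substitution.

(** * Density of the fixed points of a reduced word *)

Lemma exp2_gt_cube a b : exists m, (a * (b * m).+1 ^ 3 < 2 ^ m)%N.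
Proof.
(* [a (4 b i + 1)^3 <= a (4 b + 1)^3 (i + 1)^3 = i (i + 1)^3 < (i + 1)^4 <= 2^(4 i)]. *)
pose i := (a * (4 * b).+1 ^ 3)%N; exists (4 * i)%N.
apply: (@leq_ltn_trans (i * i.+1 ^ 3)); last first.
  apply: (@leq_ltn_trans (i.+1 ^ 4 - 1)).
    by rewrite [(_ ^ 4)%N]expnS mulSn; have := expn_gt0 i.+1 3; lia.
  apply: (@leq_trans (i.+1 ^ 4)).
    by have := expn_gt0 i.+1 4; lia.
  by rewrite mulnC expnM leq_exp2r// ltn_expl.
rewrite -mulnA leq_mul2l -expnMn leq_exp2r//; apply/orP; right.
by rewrite mulSn mulnS; nia.
Qed.

Lemma avoid2 (L : finType) (a b : L) : (2 < #|L|)%N ->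
  exists s : L, (s != a) && (s != b).
Proof.
move=> L2; apply/existsP; rewrite -[[exists s, _]]negbK negb_exists.
apply/negP => /forallP H.
have : (#|L| <= #|pred2 a b|)%N.
  apply: subset_leq_card; apply/fintype.subsetP => s _.
  by have := H s; rewrite !inE; case: eqP; case: eqP.
by rewrite card2; case: eqP => _; lia.
Qed.

(** If [z] fixed too many vertices of a graph with more than [c ^ n] vertices, the count of pairs
    would give [2 ^ m <= 2 d (n + 1)^3] with [n] proportional to [m], which fails for a suitable
    [m]. *)
Lemma fix_density_bound (L : finType) (inv : L -> L) (z : seq L) (e : nat) :
  involutive inv -> (2 < #|L|)%N -> z != [::] -> sorted (nbt inv) z ->
  exists N0 : nat, forall (R : realFieldType) (V : finType) (step : V -> L -> V),
    (forall x s, step (step x s) (inv s) = x) ->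
    (forall f : V -> R, \sum_x f x = 0 ->
       ip (adj step f) (adj step f) <= 4 * #|L|.-1%:R * ip f f) ->
    (N0 <= #|V|)%N -> (e * #|[pred x | walk step x z == x]| < #|V|)%N.
Proof.
move=> invK L2 zN sz.
have [h [z' Ez]] : exists h z', z = h :: z' by case: (z) zN => // h z' _; exists h, z'.
(* [q != h] makes [l1] and [l2] differ at the second letter; the other conditions on [q] and [p]
   make [p z q] and [p q] reduced. *)
have [q /andP[qh qz]] := avoid2 h (inv (last h z')) L2.
have [p /andP[ph pq]] := avoid2 (inv h) (inv q) L2.
have nph : nbt inv p h by rewrite /nbt -(inj_eq (can_inj invK)) invK eq_sym.
have npq : nbt inv p q by rewrite /nbt -(inj_eq (can_inj invK)) invK eq_sym.
pose l1 := p :: z ++ [:: q]; pose l2 := [:: p; q].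
have l1_l2 u v : l1 ++ u != l2 ++ v.
  by rewrite /l1 /l2 Ez /= !eqseq_cons eqxx [h == q]eq_sym (negbTE qh).
have path_l1 a : path (nbt inv) a l1 = nbt inv a p.
  rewrite /l1 Ez /= nph /= cat_path /= /nbt qz andbT.
  by move: sz; rewrite Ez /= => ->; rewrite !andbT.
have last_l2 a : last a l1 = last a l2 by rewrite /l1 /= last_cat.
have path_l2 a : path (nbt inv) a l1 -> path (nbt inv) a l2.
  by rewrite path_l1 /= npq => ->.
have size_l2 : (size l2 <= size l1)%N by rewrite /= size_cat addn1.
have sl1 : sorted (nbt inv) l1.
  rewrite /l1 /= Ez /= nph /= cat_path /= /nbt qz andbT.
  by move: sz; rewrite Ez /= => ->.
set K := size l1; set d := #|L|; set c := #|L|.-1.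
(* If [z] fixes a proportion [1 / e] of the vertices, [t] blocks contain at least one site on
   average, hence [m * t] blocks at least [m]. *)
pose t := (e * d * c ^ K)%N.
have [m Hm] := exp2_gt_cube (2 * d) (K * t).
pose n := (K * (m * t))%N; exists (c ^ n).+1 => R V step stepK normA NV.
rewrite ltnNge; apply/negP => HB.
pose B := [pred x | walk step (step x p) z == step x p].
have cB : #|B| = #|[pred x | walk step x z == x]|.
  rewrite -!sum1_card [RHS]big_mkcond -(sum_step stepK p) -big_mkcond.
  by apply: eq_bigl => x; rewrite !inE.
have walkB x : B x -> walk step x l1 = walk step x l2.
  by move=> /eqP Bx; rewrite /l1 /l2 /= walk_cat Bx.
have d0 : (0 < d)%N by rewrite /d; lia.
have c0 : (0 < c)%N by rewrite /c; lia.
have cn0 : (0 < c ^ n)%N by rewrite expn_gt0 c0.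
have N0 : (0 < #|V|)%N by apply: leq_trans NV.
have := @many_sites_bound L V inv step invK stepK B l1 l2 l1_l2 walkB size_l2
  last_l2 path_l2 R isT sl1 normA (m * t) m (ltnW L2) N0.
rewrite -/K -/n -/c -/d cB => /(_ _)/wrap[].
  apply: (@leq_trans (m * d * c ^ K * (e * #|[pred x | walk step x z == x]|))).
    by rewrite leq_mul2l HB orbT.
  apply: (@leq_trans (m * d * c ^ K * (e * #|[pred x | walk step x z == x]|) * c)).
    by rewrite leq_pmulr.
  by rewrite leq_eqVlt; apply/orP; left; apply/eqP; rewrite /t; ring.
rewrite -!(natrX, natrM, natrD) ler_nat => H.
suff : (2 ^ m <= 2 * d * n.+1 ^ 3)%N.
  by rewrite leqNgt; move: Hm; rewrite /n (mulnC m) mulnA => ->.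
have X0 : (0 < d * c ^ n * #|V|)%N by rewrite !muln_gt0 d0 cn0 N0.
rewrite -(leq_pmul2r X0); apply: leq_trans H _.
apply: (@leq_trans (n.+1 *
  (#|V| * (c ^ n * (d * n.+1) ^ 2) + #|V| * (c ^ n * (d * n.+1) ^ 2)))).
  (* As [#|V|] exceeds [c ^ n], the term coming from the constants is absorbed by the one from the
     zero-sum functions. *)
  rewrite leq_mul2l leq_add2l orFb.
  apply: (@leq_trans (#|V| * (c ^ n * d ^ 2))).
    have -> : ((d * c ^ n) ^ 2 = c ^ n * (c ^ n * d ^ 2))%N by ring.
    by rewrite leq_mul2r ltnW ?orbT.
  by rewrite !leq_mul2l expnMn leq_pmulr ?expn_gt0 ?orbT.
by rewrite leq_eqVlt; apply/orP; left; apply/eqP; ring.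
Qed.

(** * Degree at most two *)

Section DegreeTwo.
Context (L V : finType) (inv : L -> L) (step : V -> L -> V).
Hypothesis invK : involutive inv.
Hypothesis stepK : forall x s, step (step x s) (inv s) = x.
Hypothesis L2 : (#|L| <= 2)%N.
Hypothesis connV : forall A : {set V}, A != finset.set0 ->
  (forall x s, x \in A -> step x s \in A) -> A = [set: V].

Local Notation nbt := (nbt inv).
Local Notation walk := (walk step).

Lemma two_letters (a b s : L) : a != b -> s != a -> s = b.
Proof.
move=> ab sa; apply/eqP/negPn/negP => sb.
suff : (#|[:: a; b; s]| <= #|L|)%N.
  have /card_uniqP -> : uniq [:: a; b; s].
    by rewrite /= !inE negb_or ab (eq_sym a) sa (eq_sym b) sb.
  by move=> /leq_trans/(_ L2).
by apply: subset_leq_card; apply/fintype.subsetP.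
Qed.

(** At a visited vertex the next letter and the inverse of the previous one are distinct, hence are
    all the letters, so the visited vertices are closed under every step. *)
Lemma closed_walk_covers x h z :
  sorted nbt (h :: z) -> nbt (last h z) h -> walk x (h :: z) = x ->
  (#|V| <= size (h :: z))%N.
Proof.
move=> sz nz wz; set u := h :: z in sz wz *.
pose v i := walk x (take i u).
have vS i : (i < size u)%N -> v i.+1 = step (v i) (nth h u i).
  by move=> iu; rewrite /v (take_nth h iu) /walk foldl_rcons.
pose A := [set v (i : 'I_(size u)) | i in [set: 'I_(size u)]]%SET.
suff AT : A = [set: V] :> {set V}.
  by rewrite -cardsT -AT -[leqRHS]card_ord -cardsT leq_imset_card.
have vA i : (i < size u)%N -> v i \in A.
  by move=> iu; apply/finset.imsetP; exists (Ordinal iu).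
have v_end : v (size u) = v 0 by rewrite /v take_size take0.
apply: connV; first by apply/finset.set0Pn; exists (v 0); apply: vA.
move=> _ s /finset.imsetP[i _ ->]; have iu := ltn_ord i.
have [->|si] := eqVneq s (nth h u i).
  rewrite -vS//; have [iu'|] := ltnP i.+1 (size u); first exact: vA.
  by move=> /(conj iu)/andP/anti_leq ->; rewrite v_end vA.
move: iu si; case: (nat_of_ord i) => [|j] iu si.
  (* Cyclically, the letter before the first one is the last one. *)
  have -> : s = inv (last h z).
    by apply: (two_letters _ si); rewrite /nbt /= in nz *.
  rewrite -v_end (vS (size z)) // nth_last /= stepK; exact: vA.
have -> : s = inv (nth h u j).
  apply: (two_letters _ si).
  exact: (sortedP h sz).
by rewrite vS 1?ltnW// stepK vA// ltnW.
Qed.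

(** If [h] fixes two vertices, the steps [t], [h], [t], ... from one of them trace a path that turns
    back at the first other one. By connectedness this path is the whole graph, and [h] fixes only
    its ends. *)
Lemma card_fix_letter h : inv h = h -> (#|[pred x | step x h == x]| <= 2)%N.
Proof.
move=> hh; set F := [pred x | _].
have [b Fb|F0] := pickP F; last by rewrite eq_card0.
have [c /andP[cb Fc]|Fb1] := pickP [predD1 F & b]; last first.
  by rewrite (cardD1 b) (eq_card0 Fb1); case: (b \in F).
move: cb Fc; rewrite !inE => cb Fc.
have [t ht] : exists t, t != h.
  apply/existsP; rewrite -[[exists t, _]]negbK negb_exists; apply/negP => /forallP H.
  have AT : [set b]%SET = [set: V].
    apply: connV; first by apply/finset.set0Pn; exists b; rewrite inE.
    move=> x s; rewrite !inE => /eqP ->.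
    by have /negPn/eqP -> := H s; exact: Fb.
  by have := finset.in_setT c; rewrite -AT inE (negbTE cb).
have tt : inv t = t.
  apply: (@two_letters h); first by rewrite eq_sym.
  by rewrite -hh (inj_eq (can_inj invK)).
pose l i := if odd i then h else t.
have il i : inv (l i) = l i by rewrite /l; case: odd.
have lS i s : s != l i -> s = l i.+1.
  move=> si; apply: (two_letters _ si); rewrite /l /=.
  by case: (odd i); rewrite //= eq_sym.
pose v := fix v i := if i is j.+1 then step (v j) (l j) else b.
(* At [i = 0] the letter other than [l 0] is [h], which fixes [b]; this agrees with [0.-1 = 0]. *)
have v_step i s : step (v i) s = v i.+1 \/ step (v i) s = v i.-1.
  have [->|/lS si] := eqVneq s (l i); [by left|right].
  case: i si => [|i] si /=; first by rewrite si; exact/eqP/Fb.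
  suff -> : s = inv (l i) by rewrite stepK.
  by rewrite il si /l /= negbK.
have [j] : exists j, (v j == c).
  pose A := [set x | `[< exists j, v j = x >]]%SET.
  have AT : A = [set: V].
    apply: connV; first by apply/finset.set0Pn; exists b; rewrite !inE; exists 0%N.
    move=> x s; rewrite !inE => -[i <-].
    by case: (v_step i s) => ->; [exists i.+1|exists i.-1].
  by have := finset.in_setT c; rewrite -AT !inE => -[j <-]; exists j.
move=> vjc; have exj : exists j, (v j != b) && (v j \in F).
  by exists j; rewrite (eqP vjc) cb inE.
case: (ex_minnP exj) => {vjc}j /andP[vjb Fj] minj.
(* For even [j > 0] the last step of the path is by [h], which fixes [v j], so that [v j.-1 = v j],
   against minimality. *)
have oj : odd j.
  case: j vjb Fj minj => [|j] vjb Fj minj; first by rewrite /= eqxx in vjb.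
  rewrite /=; apply/negP => oj.
  have vv : v j.+1 = v j.
    by move: Fj; rewrite inE /= /l oj -{2}hh stepK => /eqP.
  by have := minj j; rewrite -vv vjb Fj ltnn => /(_ isT).
pose A := [set v (i : 'I_j.+1) | i in [set: 'I_j.+1]]%SET.
have vA i : (i <= j)%N -> v i \in A.
  by rewrite -ltnS => ij; apply/finset.imsetP; exists (Ordinal ij).
have AT : A = [set: V] :> {set V}.
  apply: connV; first by apply/finset.set0Pn; exists (v 0%N); apply: vA.
  move=> _ s /finset.imsetP[i _ ->]; have ij := ltn_ord i; rewrite ltnS in ij.
  have [->|->] := v_step i s; last by rewrite vA// (leq_trans (leq_pred _)).
  have [ij'|] := ltnP i j; first exact: vA.
  move=> /(conj ij)/andP/anti_leq ->.
  by move: Fj; rewrite inE /= /l oj => /eqP ->; rewrite vA.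
apply: (@leq_trans #|pred2 b (v j)|); last by rewrite card2 ltnS leq_b1.
apply: subset_leq_card; apply/fintype.subsetP => x Fx; rewrite inE.
have [//|xb /=] := eqVneq x b.
have : x \in A by rewrite AT inE.
move=> /finset.imsetP[i _ xi].
have := minj i; rewrite -xi xb Fx => /(_ isT) ji.
have ij : i = j :> nat by apply/anti_leq; rewrite ji -ltnS ltn_ord.
by rewrite xi ij.
Qed.

(** Removing outer letters that are inverse to each other leads either to a cyclically reduced word,
    which fixes nothing because it is shorter than [#|V|], or to a self-inverse letter. *)
Lemma card_fix_le2 z : z != [::] -> sorted nbt z -> (size z < #|V|)%N ->
  (#|[pred x | walk x z == x]| <= 2)%N.
Proof.
have [n] := ubnP (size z); elim: n z => // n IH [//|h z] zn _ sz zV.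
have [nlast|] := boolP (nbt (last h z) h).
  rewrite eq_card0// => x; apply/negP => /eqP wx.
  by have := closed_walk_covers sz nlast wx; rewrite leqNgt zV.
rewrite /nbt negbK => /eqP.
case: (lastP z) zn sz zV => [|y q] zn sz zV /=.
  by move=> hh; apply: card_fix_letter.
rewrite last_rcons => hq.
have yN : y != [::].
  by apply: contraTneq sz => -> /=; rewrite /nbt hq invK eqxx.
(* The step [h] carries the vertices fixed by the long word bijectively onto those fixed by [y]. *)
have -> : #|[pred x | walk x (h :: rcons y q) == x]| = #|[pred x | walk x y == x]|.
  rewrite -!sum1_card [RHS]big_mkcond -(sum_step stepK h) -big_mkcond.
  apply: eq_bigl => x; rewrite !inE /walk /= foldl_rcons.
  have Eh w : step (step w q) h = w by rewrite hq stepK.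
  by rewrite -(inj_eq (step_inj stepK (s := h))) Eh.
move: zn sz zV; rewrite /= size_rcons => zn sz zV.
apply: IH => //.
- exact: ltnW.
- by move: sz; rewrite rcons_path => /andP[/path_sorted].
- exact: ltn_trans zV.
Qed.

End DegreeTwo.

(** * The spectral radius of the tree *)

Local Open Scope classical_set_scope.

(** Weighted Cauchy-Schwarz: twice the difference of the sides is the sum over [i], [j] of
    [(a i h j - a j h i)^2 / (h i h j)]. *)
Lemma sum_sqr_le (R : realFieldType) (I : finType) (a h : I -> R) :
  (forall i, 0 < h i) ->
  (\sum_i a i) ^+ 2 <= (\sum_i h i) * \sum_i (a i) ^+ 2 / h i.
Proof.
move=> h0; suff : 2 * (\sum_i a i) ^+ 2 <=
    2 * ((\sum_i h i) * \sum_i (a i) ^+ 2 / h i) by lra.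
have -> : 2 * ((\sum_i h i) * \sum_i (a i) ^+ 2 / h i) =
    \sum_i \sum_j (h i * (a j ^+ 2 / h j) + h j * (a i ^+ 2 / h i)).
  under [RHS]eq_bigr do rewrite big_split /= -mulr_sumr -mulr_suml.
  by rewrite [RHS]big_split /= -mulr_suml -mulr_sumr; ring.
rewrite expr2 mulr_suml mulr_sumr; apply: ler_sum => i _.
rewrite mulr_sumr mulr_sumr; apply: ler_sum => j _.
have hi := h0 i; have hj := h0 j; rewrite -subr_ge0.
have -> : h i * (a j ^+ 2 / h j) + h j * (a i ^+ 2 / h i) - 2 * (a i * a j) =
    (a i * h j - a j * h i) ^+ 2 / (h i * h j).
  by field; rewrite !lt0r_neq0.
by rewrite divr_ge0 ?sqr_ge0// mulr_ge0 ?ltW.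
Qed.

(** * The Schur test *)

Section Schur.
Context (R : realType).
Local Open Scope ereal_scope.

Lemma esumZl_le (T : choiceType) (k : R) (a : T -> \bar R) :
  (0 <= k)%R -> (forall x, 0 <= a x) ->
  \esum_(x in [set: T]) (k%:E * a x) <= k%:E * \esum_(x in [set: T]) a x.
Proof.
move=> k0 a0; apply: ge_ereal_sup => _ [X [finX _] <-].
rewrite -ge0_mule_fsumr//; apply: lee_wpmul2l => //.
by apply: esum_ge; exists X.
Qed.

Definition sqsum (T : choiceType) (f : T -> R) : \bar R :=
  \esum_(x in [set: T]) (`|f x| ^+ 2)%:E.

Lemma sqsum_le (T : choiceType) (f : T -> R) (k : R) : (0 <= k)%R ->
  (l2norm f <= k%:E) = (sqsum f <= (k ^+ 2)%:E).
Proof.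
move=> k0; rewrite /l2norm -/(sqsum f).
have -> : k%:E = sqrte (k ^+ 2)%:E by rewrite /= sqrtr_sqr ger0_norm.
by rewrite lee_sqrt// lee_fin sqr_ge0.
Qed.

Variables (G : lgraph) (h : vertex G -> R) (lam : R).

Lemma esum_step s (a : vertex G -> \bar R) :
  \esum_(x in [set: vertex G]) a (step x s) = \esum_(x in [set: vertex G]) a x.
Proof.
rewrite [RHS](@reindex_esum R _ _ [set: vertex G] [set: vertex G] (fun x => step x s) a)//.
split => //.
- by move=> x y _ _ /(congr1 (fun v => step v (linv s))); rewrite !stepK.
- by move=> x _; exists (step x (linv s)) => //; rewrite -{2}[s]linvK stepK.
Qed.

Hypothesis h0 : forall x, (0 < h x)%R.
Hypothesis hlam : forall x, (\sum_s h (step x s) <= lam * h x)%R.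

(** Cauchy-Schwarz at each vertex uses the values of [h] at the neighbours as weights. [hlam] bounds
    their sum, and is used again after exchanging the sums, the graph being undirected. *)
Lemma schur_test (f : vertex G -> R) :
  sqsum (fun x => \sum_s f (step x s))%R <= (lam ^+ 2)%:E * sqsum f.
Proof.
have hge0 x : (0 <= h x)%R by exact: ltW.
have pos x y : 0 <= (h x * (f y ^+ 2 / h y))%:E.
  by rewrite lee_fin mulr_ge0// divr_ge0// sqr_ge0.
have hinv x : (\sum_s h (step x (linv s)) <= lam * h x)%R.
  by apply: le_trans (hlam x); rewrite [leRHS](reindex_inj (can_inj (@linvK G))).
have [x0|noV] := pselect (exists x : vertex G, True); last first.
  by rewrite /sqsum !esum1 ?mule0// => x; case: noV; exists x.
have l0 : (0 <= lam)%R.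
  case: x0 => x _; have := hlam x; rewrite leNgt; apply: contraNle => ln.
  apply: (@lt_le_trans _ _ 0%R); first by rewrite nmulr_rlt0.
  by apply: sumr_ge0 => s _; exact: ltW.
apply: (@le_trans _ _ (\esum_(x in [set: vertex G])
    (lam%:E * \sum_s (h x * (f (step x s) ^+ 2 / h (step x s)))%:E))).
  apply: le_esum => x _; rewrite sumEFin -EFinM lee_fin real_normK ?num_real//.
  apply: (le_trans (sum_sqr_le _ (fun s => h0 (step x s)))).
  rewrite -mulr_sumr mulrA ler_wpM2r//; apply: sumr_ge0 => s _.
  by rewrite mulr_ge0 ?sqr_ge0// invr_ge0 ltW.
apply: (le_trans (esumZl_le l0 _)).
  by move=> x; apply: sume_ge0.
rewrite expr2 EFinM -muleA; apply: lee_wpmul2l; first by rewrite lee_fin.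
rewrite esum_sum//.
under eq_bigr => s _.
  (* Taking [step x s] as the new variable moves the weight to a neighbour of it. *)
  have -> : \esum_(x in [set: vertex G]) (h x * (f (step x s) ^+ 2 / h (step x s)))%:E
     = \esum_(x in [set: vertex G]) (h (step x (linv s)) * (f x ^+ 2 / h x))%:E.
    rewrite -[RHS](esum_step s); apply: eq_esum => x _.
    by rewrite stepK.
  over.
rewrite -esum_sum//; apply: le_trans (esumZl_le l0 _).
  apply: le_esum => x _; rewrite sumEFin -EFinM lee_fin -mulr_suml.
  rewrite real_normK ?num_real//.
  have -> : (lam * f x ^+ 2 = f x ^+ 2 / h x * (lam * h x))%R.
    by field; rewrite lt0r_neq0.
  by rewrite [leRHS]mulrC ler_wpM2r// divr_ge0// sqr_ge0.
by move=> x; rewrite lee_fin sqr_ge0.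
Qed.

End Schur.

Section TreeRadius.
Context (R : realType) (d : nat).
Hypothesis d1 : (1 < d)%N.

Let q : R := Num.sqrt d.-1%:R.

Let q0 : 0 < q.
Proof. by rewrite sqrtr_gt0 ltr0n; case: d d1 => [|[]]. Qed.

Let qq : q ^+ 2 = d.-1%:R.
Proof. by rewrite sqr_sqrtr. Qed.

(** Away from the root this is an equality: one neighbour is shorter, [d - 1] are longer, and
    [q^2 = d - 1]. At the root it says [d <= 2 (d - 1)]. *)
Lemma tree_weight_le (w : vertex (regular_tree d)) :
  \sum_s q ^- size (val (step w s)) <= 2 * q * q ^- size (val w).
Proof.
have qN := lt0r_neq0 q0; rewrite /=.
case: (val w) => [|t u] /=.
  rewrite sumr_const card_ord expr0 invr1 mulr1 expr1 -[_ *+ d]mulr_natl.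
  rewrite ler_pdivrMr// -mulrA -expr2 qq -natrM ler_nat.
  by case: d d1 => // n; lia.
rewrite (bigD1 t)//= eqxx (eq_bigr (fun=> q ^- (size u).+2)); last first.
  by move=> s; rewrite eq_sym => /negbTE ->.
rewrite sumr_const cardC1 card_ord -[_ *+ d.-1]mulr_natl -qq.
rewrite le_eqVlt; apply/orP; left; apply/eqP.
by rewrite !exprS; field; rewrite expf_neq0.
Qed.

Lemma spectral_radius_tree :
  (spectral_radius R (regular_tree d) <= (2 * q / d%:R)%:E)%E.
Proof.
have d0 : (0 : R) < d%:R by rewrite ltr0n ltnW.
apply: ge_ereal_sup => _ [f [_ f1] <-].
rewrite (@sqsum_le _ _ _ 1)// expr1n in f1.
rewrite sqsum_le; last by rewrite divr_ge0 ?mulr_ge0// ltW.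
have -> : sqsum (@Defs.markov R (regular_tree d) f) =
  \esum_(x in [set: vertex (regular_tree d)])
    ((d%:R^-1 ^+ 2)%:E * (`|\sum_s f (step x s)| ^+ 2)%:E)%E.
  apply: eq_esum => x _; rewrite -EFinM -exprMn /Defs.markov normrM ger0_norm//.
  by rewrite /degree card_ord.
have h0 (x : vertex (regular_tree d)) : 0 < q ^- size (val x).
  by rewrite invr_gt0 exprn_gt0.
apply: (le_trans (esumZl_le (sqr_ge0 _) _)) => [x|].
  by rewrite lee_fin sqr_ge0.
rewrite (_ : (2 * q / d%:R) ^+ 2 = d%:R^-1 ^+ 2 * (2 * q) ^+ 2); last first.
  by rewrite exprMn mulrC.
rewrite [leRHS](EFinM (d%:R^-1 ^+ 2)); apply: lee_wpmul2l.
  by rewrite lee_fin sqr_ge0.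
apply: le_trans (schur_test h0 tree_weight_le f) _.
by rewrite -[leRHS]mule1; apply: lee_wpmul2l; rewrite ?lee_fin ?sqr_ge0.
Qed.

End TreeRadius.

(** * Finite graphs and their cycles *)

Section FiniteGraph.
Context (G : lgraph) (finG : finite_graph G).

Definition verts : {fset vertex G} := fset_set [set: vertex G].

Lemma in_verts x : x \in verts.
Proof. by rewrite in_fset_set// in_setT. Qed.

Definition fstep (x : verts) (s : label G) : verts :=
  [` in_verts (step (val x) s)]%fset.

Lemma fstepK x s : fstep (fstep x s) (linv s) = x.
Proof. by apply: val_inj; rewrite /= stepK. Qed.

Lemma val_walk x u : val (walk fstep x u) = foldl (@step G) (val x) u.
Proof. by elim: u x => //= s u IH x; rewrite IH. Qed.

Lemma card_verts : #|{: verts}| = order_graph G.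
Proof. by rewrite /order_graph cardfE. Qed.

Definition nfix (u : seq (label G)) : nat :=
  #|[pred x : verts | walk fstep x u == x]|.

Section Norm.
Context (R : realType).

Lemma sqsum_fin (f : vertex G -> R) :
  sqsum f = (\sum_(x : verts) f (val x) ^+ 2)%:E.
Proof.
rewrite /sqsum esum_fset// fsbig_finite// big_seq_fsetE /= -sumEFin.
by apply: eq_bigr => x _; rewrite real_normK ?num_real.
Qed.

(** The test function is [f] scaled to norm 1; the degree in the Markov operator cancels against the
    one in the tree bound. *)
Lemma ramanujan_norm : ramanujan R G -> (1 < degree G)%N ->
  forall f : verts -> R, \sum_x f x = 0 ->
  ip (adj fstep f) (adj fstep f) <= 4 * #|label G|.-1%:R * ip f f.
Proof.
move=> [_ ram] d1 f f0.
have ipE (g : verts -> R) : ip g g = \sum_x g x ^+ 2.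
  by apply: eq_bigr => x _; rewrite expr2.
rewrite !ipE; set E := \sum_x f x ^+ 2.
have E0 : 0 <= E by apply: sumr_ge0 => x _; exact: sqr_ge0.
have [E1|EN] := eqVneq E 0.
  have fx x : f x = 0.
    move/eqP: E1; rewrite psumr_eq0; last by move=> y _; exact: sqr_ge0.
    by move=> /allP/(_ x); rewrite mem_index_enum sqrf_eq0 => /(_ isT)/eqP.
  rewrite E1 mulr0 big1// => x _; rewrite /adj big1 ?expr0n// => s _.
have Ep : 0 < E by rewrite lt_neqAle eq_sym EN.
pose g (x : vertex G) : R := f [` in_verts x]%fset / Num.sqrt E.
have gE (x : verts) : g (val x) = f x / Num.sqrt E.
  by rewrite /g; congr (f _ / _); apply: val_inj.
have d0 : 0 < (degree G)%:R :> R by rewrite ltr0n ltnW.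
have bound : (l2norm (Defs.markov g) <=
    (2 * Num.sqrt (degree G).-1%:R / (degree G)%:R)%:E)%E.
  apply: le_trans (spectral_radius_tree R d1); apply: le_trans ram.
  apply: ereal_sup_ubound; exists g => //; split.
    rewrite /zero_sum /= fsbig_finite// big_seq_fsetE /=.
    under eq_bigr do rewrite gE.
    by rewrite -mulr_suml f0 mul0r.
  rewrite (@sqsum_le _ _ _ 1)// expr1n sqsum_fin lee_fin.
  under eq_bigr do rewrite gE exprMn exprVn sqr_sqrtr//.
  by rewrite -mulr_suml mulfV.
rewrite sqsum_le in bound; last first.
  by rewrite divr_ge0 ?mulr_ge0 ?sqrtr_ge0// ltW.
move: bound; rewrite sqsum_fin lee_fin.
have -> : \sum_(x : verts) Defs.markov g (val x) ^+ 2 =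
    (\sum_x adj fstep f x ^+ 2) / (E * (degree G)%:R ^+ 2).
  rewrite mulr_suml; apply: eq_bigr => x _.
  have -> : Defs.markov g (val x) = (degree G)%:R^-1 * (adj fstep f x / Num.sqrt E).
    rewrite /Defs.markov /adj; congr (_ * _); rewrite mulr_suml.
    by apply: eq_bigr => s _; rewrite -(gE (fstep x s)).
  rewrite !exprMn !exprVn sqr_sqrtr//; field.
  by rewrite EN lt0r_neq0.
rewrite ler_pdivrMr; last by rewrite mulr_gt0// exprn_gt0.
rewrite !exprMn sqr_sqrtr// => /le_trans; apply.
rewrite le_eqVlt; apply/orP; left; apply/eqP; rewrite /degree in d0 *.
by field; rewrite lt0r_neq0.
Qed.

End Norm.

Fixpoint darts (x : vertex G) (u : seq (label G)) : seq (dart G) :=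
  if u is s :: u' then (x, s) :: darts (step x s) u' else [::].

(** For a cycle the closing dart [e0] is [e] itself; the induction needs it arbitrary. *)
Lemma dart_path_darts (e0 e : dart G) p :
  path (fun e e' : dart G => step e.1 e.2 == e'.1) e (rcons p e0) ->
  e :: p = darts e.1 [seq a.2 | a <- e :: p] /\
  foldl (@step G) e.1 [seq a.2 | a <- e :: p] = e0.1.
Proof.
elim: p e => [|a p IH] e /=; first by rewrite andbT => /eqP ->; case: e.
move=> /andP[/eqP ea /IH[pE wE]]; rewrite ea; split; last exact: wE.
by rewrite [in LHS]pE /=; case: e {ea}.
Qed.

Lemma dart_revK (e : dart G) : dart_rev (dart_rev e) = e.
Proof. by case: e => x s; rewrite /dart_rev /= stepK linvK. Qed.

Lemma edge_of_rev (e : dart G) : edge_of (dart_rev e) = edge_of e.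
Proof. by rewrite /edge_of dart_revK setUC. Qed.

(** A backtracking step would use the same undirected edge twice in a row. *)
Lemma sorted_nbt_labels (p : seq (dart G)) :
  sorted (fun e e' : dart G => step e.1 e.2 == e'.1) p ->
  uniq [seq edge_of e | e <- p] ->
  sorted (nbt (@linv G)) [seq e.2 | e <- p].
Proof.
case: p => // e p; elim: p e => [//|a p IH] e.
rewrite /= => /andP[/eqP ea ap] /andP[eu ua]; have /= -> := IH a ap ua.
rewrite andbT; move: eu; rewrite inE negb_or => /andP[+ _].
apply: contraNneq => a2; rewrite -edge_of_rev; apply/eqP; congr edge_of.
by rewrite /dart_rev ea -a2; case: (a).
Qed.

(** A cycle is recovered from one of its vertices and the labels read from there. Different choices
    may give the same cycle, whence an inequality. *)
Lemma cycle_count_le n :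
  (cycle_count G n <= \sum_(z : n.-tuple (label G) |
     (val z != [::]) && sorted (nbt (@linv G)) z) nfix z)%N.
Proof.
pose D := [set t : verts * n.-tuple (label G) |
  [&& val t.2 != [::], sorted (nbt (@linv G)) t.2 & walk fstep t.1 t.2 == t.1]]%SET.
have -> : (\sum_(z : n.-tuple (label G) |
     (val z != [::]) && sorted (nbt (@linv G)) z) nfix z = #|D|)%N.
  rewrite -sum1_card (eq_bigl (fun t : verts * n.-tuple (label G) =>
    ((val t.2 != [::]) && sorted (nbt (@linv G)) t.2) &&
    (walk fstep t.1 t.2 == t.1))); last by move=> t; rewrite inE andbA.
  rewrite -(pair_big_dep xpredT (fun x (z : n.-tuple (label G)) =>
    ((val z != [::]) && sorted (nbt (@linv G)) z) && (walk fstep x z == x))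
    (fun _ _ => 1%N)) /=.
  rewrite (exchange_big_dep (fun z : n.-tuple (label G) =>
    (val z != [::]) && sorted (nbt (@linv G)) z)) /=; last by move=> x z _ /andP[].
  apply: eq_bigr => z zP; rewrite /nfix -sum1_card; apply: eq_bigl => x.
  by rewrite zP inE.
pose g (t : verts * n.-tuple (label G)) :=
  [set edge_of e | e in [set` darts (val t.1) t.2]].
have sub : @cycles G n `<=` [set` [fset g t | t in D]%fset].
  move=> _ [p [[pN cp _ ue] sp ->]].
  case: p pN cp ue sp => // e p _ cp ue sp.
  have [pE wE] := dart_path_darts cp.
  have sz : size [seq a.2 | a <- e :: p] == n by rewrite size_map sp.
  apply/imfsetP; exists ([` in_verts e.1]%fset, Tuple sz); last first.
    by rewrite /g /= {1}pE.
  rewrite inE; apply/and3P; split => //=.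
    apply: (sorted_nbt_labels _ ue).
    by move: cp; rewrite /= rcons_path => /andP[].
  by apply/eqP/val_inj; rewrite val_walk.
have fin : finite_set (@cycles G n) by apply: sub_finite_set sub _.
rewrite /cycle_count; apply: (@leq_trans #|` [fset g t | t in D]%fset|); last first.
  by rewrite (leq_trans (leq_imfset_card _ _ _))// -cardE.
apply: fsubset_leq_card; apply/fsubsetP => C.
by rewrite in_fset_set// => /set_mem/sub.
Qed.

End FiniteGraph.

(** * Free generation *)

Section FreeGeneration.
Context (Gamma : groupType) (S : {fset Gamma}).
Hypothesis symS : symmetric_set S.
Hypothesis genS : generates S.

Local Open Scope group_scope.

Definition nocancel (a b : Gamma) : bool := b != a^-1.

Lemma sorted_catr (T : Type) (r : rel T) (u v : seq T) x y :
  sorted r (rcons u x) -> r x y -> sorted r (y :: v) ->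
  sorted r (rcons u x ++ y :: v).
Proof.
case: u => [|a u] /=; first by move=> _ -> ->.
by rewrite cat_path /= last_rcons => -> -> ->.
Qed.

Hypothesis reduced_neq1 : forall u : seq Gamma,
  {subset u <= S} -> sorted nocancel u -> u != [::] -> \prod_(x <- u) x != 1.

Lemma prod_rev_inv (u : seq Gamma) :
  \prod_(x <- rev [seq x^-1 | x <- u]) x = (\prod_(x <- u) x)^-1.
Proof.
elim: u => [|a u IH]; first by rewrite !big_nil invg1.
by rewrite /= rev_cons big_rcons big_cons /= IH invgM.
Qed.

(** At the first difference, the inverse of one remaining word followed by the other is reduced and
    non-empty, but has product 1. *)
Lemma reduced_inj (u v : seq Gamma) : {subset u <= S} -> {subset v <= S} ->
  sorted nocancel u -> sorted nocancel v ->
  \prod_(x <- u) x = \prod_(x <- v) x -> u = v.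
Proof.
elim: u v => [|a u IH] [|b v] // uS vS su sv.
- rewrite big_nil => /esym/eqP; apply: contraTeq => _.
  exact: reduced_neq1 vS sv isT.
- rewrite big_nil => /eqP; apply: contraTeq => _.
  exact: reduced_neq1 uS su isT.
move=> uv; have [ab|ab] := eqVneq a b.
  rewrite ab (IH v)//.
  - by move=> x xu; apply: uS; rewrite inE xu orbT.
  - by move=> x xv; apply: vS; rewrite inE xv orbT.
  - exact: path_sorted su.
  - exact: path_sorted sv.
  - by move: uv; rewrite !big_cons ab => /mulgI.
have := @reduced_neq1 (rev [seq x^-1 | x <- b :: v] ++ a :: u).
rewrite big_cat prod_rev_inv uv /= mulVg eqxx => H; exfalso.
have : false; last by [].
apply: H => //.
- move=> x; rewrite mem_cat mem_rev -(map_cons (fun x => x^-1)) => /orP[|/uS//].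
  by move=> /mapP[y /vS yS ->]; exact: symS.
- rewrite rev_cons; apply: sorted_catr => //; last first.
    by rewrite /nocancel invgK.
  rewrite -rev_cons rev_sorted -(map_cons (fun x => x^-1)) sorted_map.
  apply: sub_sorted sv => x y; rewrite /nocancel /= invgK.
  by rewrite eq_sym.
- by case: (rev _).
Qed.

Hypothesis noinv : no_involution S.

(** [no_involution] leaves only [s = 1], which the reduced word [[:: s]] excludes. *)
Lemma gen_neq_inv s : s \in S -> s != s^-1.
Proof.
move=> sS; apply/eqP => ss.
have s1 : s = 1 by apply: noinv => //; rewrite {1}ss mulVg.
have : \prod_(x <- [:: s]) x != 1.
  by apply: reduced_neq1 => // x; rewrite inE => /eqP ->.
by rewrite big_seq1 s1 eqxx.
Qed.

(** The order in which [S] is listed serves to choose one element from each pair of inverses. *)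
Definition basis : set Gamma :=
  [set s | s \in S /\ (index s S <= index s^-1 S)%N].

Lemma basis_inv x : basis x -> ~ basis x^-1.
Proof.
move=> [xS xi] [xS' xi']; move/eqP: (gen_neq_inv xS); apply.
rewrite invgK in xi'; apply: (index_inj x xS xS').
by apply/anti_leq; rewrite /= xi.
Qed.

Lemma basis_total s : s \in S -> basis s \/ basis s^-1.
Proof.
move=> sS; have [si|si] := leqP (index s S) (index s^-1 S).
  by left; split.
by right; split; [exact: symS|rewrite invgK ltnW].
Qed.

Lemma letter_val_inj (a b : Gamma * bool) :
  basis a.1 -> basis b.1 -> letter_val a = letter_val b -> a = b.
Proof.
case: a b => [x []] [y []] /= bx xy; rewrite /letter_val /=.
- by move=> /invg_inj ->.
- by move=> xE; rewrite -xE in xy; case: (basis_inv bx).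
- by move=> xE; rewrite xE in bx; case: (basis_inv xy).
- by move=> ->.
Qed.

Lemma letter_in (a : Gamma * bool) : basis a.1 -> letter_val a \in S.
Proof. by case: a => x [] [xS _]; rewrite /letter_val //=; exact: symS. Qed.

Definition flip (a : Gamma * bool) : Gamma * bool := (a.1, ~~ a.2).

Lemma letter_flip a : letter_val (flip a) = (letter_val a)^-1.
Proof. by case: a => x []; rewrite /letter_val /= ?invgK. Qed.

Lemma reduced_word_sorted w : reduced_word basis w ->
  sorted nocancel (map (@letter_val Gamma) w).
Proof.
move=> [wX sw]; rewrite sorted_map.
apply: (sub_in_sorted (P := fun a => `[< basis a.1 >]) _ _ sw); last first.
  by apply/allP => a /wX aX; apply/asboolP.
move=> a b /asboolP aX /asboolP bX /=; rewrite /nocancel; apply: contra.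
move=> /eqP; rewrite -letter_flip => /(@letter_val_inj b (flip a) bX aX) ->.
by rewrite /= eqxx; case: (a.2).
Qed.

(** Letters are prepended one at a time to a reduced word; a letter that meets its inverse cancels
    it. *)
Lemma reduce_word w : (forall a, a \in w -> basis a.1) ->
  exists2 w', reduced_word basis w' &
    \prod_(a <- w') letter_val a = \prod_(a <- w) letter_val a.
Proof.
elim: w => [|a w IH] wX; first by exists [::].
rewrite big_cons; have [|w' rw' <-] := IH.
  by move=> b bw; apply: wX; rewrite inE bw orbT.
have aX : basis a.1 by apply: wX; rewrite mem_head.
case: w' rw' => [|b w'] [wX' sw'].
  by exists [:: a]; rewrite ?big_cons//; split => // b; rewrite inE => /eqP ->.
have [/andP[/eqP ab1 ab2]|ab] := boolP ((a.1 == b.1) && (a.2 != b.2)).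
  have ba : b = flip a.
    by case: (a) (b) ab1 ab2 => [x []] [y []] //= ->.
  exists w'; last by rewrite big_cons ba letter_flip mulgA mulgV mul1g.
  split; last exact: path_sorted sw'.
  by move=> c cw; apply: wX'; rewrite inE cw orbT.
exists [:: a, b & w']; last by rewrite big_cons.
split; first by move=> c; rewrite inE => /orP[/eqP -> //|]; exact: wX'.
by rewrite /= ab.
Qed.

Lemma basis_generates g :
  exists2 w, (forall a, a \in w -> basis a.1) & \prod_(a <- w) letter_val a = g.
Proof.
(* These products form a subgroup containing [S]; a word is inverted by reversing it and flipping
   its letters. *)
pose K := [set g | exists2 w, (forall a, a \in w -> basis a.1) &
  \prod_(a <- w) letter_val a = g].
suff KT : K = setT by have : K g by rewrite KT.
apply: genS.
  split; first by apply/mem_set; exists [::]; rewrite ?big_nil.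
  move=> x y /set_mem[u uX <-] /set_mem[v vX <-]; apply/mem_set.
  exists (u ++ rev (map flip v)).
    move=> a; rewrite mem_cat mem_rev => /orP[/uX//|/mapP[b /vX bX ->]].
    exact: bX.
  rewrite big_cat /=; congr (_ * _).
  elim: v {vX} => [|a v IH]; first by rewrite !big_nil invg1.
  by rewrite /= rev_cons big_rcons big_cons /= IH letter_flip invgM.
move=> s /= sS; case: (basis_total sS) => sX.
  exists [:: (s, false)]; last by rewrite big_seq1.
  by move=> a; rewrite inE => /eqP ->.
exists [:: (s^-1, true)]; last by rewrite big_seq1 /letter_val /= invgK.
by move=> a; rewrite inE => /eqP ->.
Qed.

Lemma freely_generatedP : freely_generated S.
Proof.
exists basis; split.
- by move=> x [].
- move=> s sS; case: (basis_total sS) => sX.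
    exists s; split; first by split; [|left].
    by move=> y [yX []// ys]; rewrite ys in yX; case: (basis_inv sX).
  exists s^-1; split; first by split; [|right].
  move=> y [yX []// ys]; rewrite -ys in sX; by case: (basis_inv yX).
move=> g; have [w wX <-] := basis_generates g.
have [w' rw' <-] := reduce_word wX; exists w'; split=> // v [rv vw'].
have wS u : reduced_word basis u -> {subset map (@letter_val Gamma) u <= S}.
  by move=> [uX _] _ /mapP[a /uX/letter_in aS ->].
have E : map (@letter_val Gamma) w' = map (@letter_val Gamma) v.
  apply: reduced_inj; [exact: wS|exact: wS| | |].
  - exact: reduced_word_sorted.
  - exact: reduced_word_sorted.
  - by rewrite !big_map.
case: rw' rv => wX' _ [vX _] {vw'}.
elim: w' v E wX' vX => [|a w' IH] [|b v] //= [ab E] wX' vX.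
have aX : basis a.1 by apply: wX'; rewrite mem_head.
have bX : basis b.1 by apply: vX; rewrite mem_head.
have [wX1 vX1] : (forall c, c \in w' -> basis c.1) /\
    (forall c, c \in v -> basis c.1).
  by split=> c cw; [apply: wX'|apply: vX]; rewrite inE cw orbT.
by rewrite (@letter_val_inj a b aX bX ab) (IH v E wX1 vX1).
Qed.

End FreeGeneration.

(** * Schreier graphs *)

Lemma coset_mul1 (Gamma : groupType) (A : set Gamma) : coset_mul A 1%g = A.
Proof. by have := coset_mulK A 1%g; rewrite coset_mulM mulgV. Qed.

Lemma coset_mulVK (Gamma : groupType) (A : set Gamma) (g : Gamma) :
  coset_mul (coset_mul A g^-1%g) g = A.
Proof. by rewrite coset_mulM mulVg coset_mul1. Qed.

Section SchreierGraph.
Context (Gamma : groupType) (S : {fset Gamma}) (symS : symmetric_set S).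
Context (H : set Gamma).

Local Notation G := (Schreier H symS).

Lemma Schreier_order : finite_index H -> finite_graph G ->
  order_graph G = index_of H.
Proof.
move=> finH finG; rewrite /index_of /order_graph.
have -> : fset_set (right_cosets H) =
    [fset val x | x in fset_set [set: vertex G]]%fset.
  apply/fsetP => A; rewrite in_fset_set//; apply/idP/imfsetP => /=.
    by move=> AH; exists (SigSub AH) => //; rewrite in_fset_set// in_setT.
  by move=> [x _ ->]; exact: valP x.
by rewrite card_imfset//; exact: val_inj.
Qed.

Lemma val_walk_Schreier (x : vertex G) (u : seq S) :
  val (foldl (@step G) x u) = coset_mul (val x) (\prod_(s <- u) val s)%g.
Proof.
elim: u x => [|s u IH] x; last by rewrite /= IH big_cons /= coset_mulM.
by rewrite big_nil coset_mul1.
Qed.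

(** The group acts transitively on the cosets, and the translations preserving the given set form a
    subgroup containing [S]. *)
Lemma Schreier_connected (genS : generates S) (finG : finite_graph G)
    (A : {set verts G}) : A != finset.set0 ->
  (forall x s, x \in A -> fstep finG x s \in A) -> A = [set: verts G]%SET.
Proof.
move=> /finset.set0Pn[x xA] stepA.
pose A' : set (set Gamma) := [set val (val y) | y in [set` A]].
pose K : set Gamma := [set g | forall B, A' B <-> A' (coset_mul B g)].
have stepA' B s : s \in S -> A' B -> A' (coset_mul B s).
  move=> sS [y yA <-]; exists (fstep finG y [` sS]%fset) => //.
  exact: stepA.
have KT : K = setT.
  apply: genS.
    split; first by apply/mem_set => B; rewrite coset_mul1.
    move=> g h /set_mem Kg /set_mem Kh; apply/mem_set => B.
    rewrite -coset_mulM; split; rewrite (Kg B) => Bg.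
      by apply/(Kh _); rewrite coset_mulVK.
    by have /(Kh _) := Bg; rewrite coset_mulVK.
  move=> s sS B; split; first exact: stepA'.
  by move=> /(stepA' _ _ (symS sS)); rewrite coset_mulK.
apply/finset.setP => y; rewrite finset.in_setT.
have [/set_mem[g _ gE] /set_mem[h _ hE]] := (valP (val x), valP (val y)).
have /(_ (val (val x))) : K (g^-1 * h)%g by rewrite KT.
case=> + _; case; first by exists x.
move=> z zA; rewrite -gE coset_mulM mulgA mulgV mul1g hE => /val_inj/val_inj <-.
exact: zA.
Qed.

End SchreierGraph.

(** * Sequences of Ramanujan Schreier graphs *)

Section Sequence.
Context (R : realType) (Gamma : groupType) (S : {fset Gamma}).
Context (symS : symmetric_set S) (genS : generates S).
Context (H : nat -> set Gamma).
Hypothesis finH : forall n, finite_index (H n).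
Hypothesis indexH : index_of (H n) @[n --> \oo] --> \oo.
Hypothesis ramH : forall n, ramanujan R (Schreier (H n) symS).

Local Notation G n := (Schreier (H n) symS).

Let finG n : finite_graph (G n) := (ramH n).1.

Lemma nfix_small (z : seq S) e : z != [::] -> sorted (nbt (gen_inv symS)) z ->
  \forall n \near \oo, (e * nfix (finG n) z < order_graph (G n))%N.
Proof.
move=> zN sz.
suff [N0 HN0] : exists N0 : nat, forall n, (N0 <= #|{: verts (G n)}|)%N ->
    (e * nfix (finG n) z < #|{: verts (G n)}|)%N.
  have /cvgnyPge/(_ N0) := indexH; apply: filterS => n.
  by rewrite -(Schreier_order (finH n) (finG n)) -card_verts; exact: HN0.
have [S2|S2] := ltnP 2 #|{: S}|.
  have [N0 HN0] := fix_density_bound e (@gen_invK _ _ symS) S2 zN sz.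
  exists N0 => n; apply: (HN0 R) => [x s|]; first exact: fstepK.
  by apply: ramanujan_norm (ramH n) _; exact: ltnW S2.
(* Beyond this threshold [z] is shorter than the number of vertices, and two vertices are less than
   a proportion [1 / e]. *)
exists (maxn (size z) (e * 2)).+1 => n; rewrite gtn_max => /andP[zV eV].
apply: leq_ltn_trans eV; rewrite leq_mul2l; apply/orP; right.
apply: (card_fix_le2 (@gen_invK _ _ symS) (@fstepK _ (finG n)) S2) => //.
exact: Schreier_connected.
Qed.

(** A word with product 1 fixes every vertex, against [nfix_small] with [e = 1]. *)
Lemma reduced_prod_neq1 (u : seq Gamma) :
  {subset u <= S} -> sorted (@nocancel Gamma) u -> u != [::] ->
  (\prod_(x <- u) x != 1)%g.
Proof.
move=> uS su uN; apply/negP => /eqP u1.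
have [z zu] : exists z : seq S, map val z = u.
  elim: u uS {su uN u1} => [|a u IH] uS; first by exists [::].
  have [|z zu] := IH; first by move=> x xu; apply: uS; rewrite inE xu orbT.
  by exists ([` uS a (mem_head _ _)]%fset :: z); rewrite /= zu.
have zN : z != [::] by case: (z) zu uN => // <-.
have sz : sorted (nbt (gen_inv symS)) z.
  by move: su; rewrite -zu sorted_map.
have [N _ /(_ N (leqnn N))/=] := nfix_small 1 zN sz.
rewrite mul1n -card_verts ltnNge => /negP; apply.
apply: subset_leq_card; apply/fintype.subsetP => x _; rewrite inE.
apply/eqP; rewrite val_walk val_walk_Schreier.
by rewrite -(big_map val xpredT id) zu u1 coset_mul1.
Qed.

Lemma Schreier_large_girth : essentially_large_girth R (fun n => G n).
Proof.
move=> l; apply/cvgrPdist_lt => eps eps0.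
pose T := #|{: l.-tuple S}|.
(* Each of the at most [T] words will fix less than a proportion [1 / e] of the vertices, and
   [T / e < eps]. *)
pose e := (Num.truncn (T%:R / eps : R)).+1.
have near_all : \forall n \near \oo, forall z : l.-tuple S,
    (val z != [::]) && sorted (nbt (gen_inv symS)) z ->
    (e * nfix (finG n) z < order_graph (G n))%N.
  apply: filter_forall => z.
  have [/andP[zN sz]|_] := boolP ((val z != [::]) && _).
    by apply: filterS (nfix_small e zN sz) => n + _.
  exact: nearW.
apply: filterS near_all => n small.
(* Without vertices the quotient is 0, the inverse of 0 being 0. *)
have [N0|] := posnP (order_graph (G n)).
  by rewrite N0 invr0 mulr0 subrr normr0.
move=> Npos; rewrite sub0r normrN ger0_norm; last by rewrite divr_ge0.
have NR : (0 : R) < (order_graph (G n))%:R by rewrite ltr0n.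
rewrite ltr_pdivrMr//.
have le1 : (e * cycle_count (G n) l <= T * order_graph (G n))%N.
  apply: (@leq_trans (e * \sum_(z : l.-tuple S |
     (val z != [::]) && sorted (nbt (gen_inv symS)) z) nfix (finG n) z)).
    by rewrite leq_mul2l cycle_count_le orbT.
  rewrite big_distrr /= /T -sum_nat_const big_mkcond; apply: leq_sum => z _.
  by case: ifP => // /small /ltnW.
have e0 : (0 : R) < e%:R by rewrite ltr0n.
rewrite -(ltr_pM2l e0) -natrM; apply: (@le_lt_trans _ _ (T * order_graph (G n))%:R).
  by rewrite ler_nat.
rewrite natrM mulrA ltr_pM2r// -ltr_pdivrMr//.
exact: truncnS_gt.
Qed.

End Sequence.

Theorem theorem6 (R : realType) (Gamma : groupType) (S : {fset Gamma})
    (symS : symmetric_set S) (genS : generates S)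
    (H : nat -> set Gamma)
    (subH : forall n, is_subgroup (H n))
    (finH : forall n, finite_index (H n))
    (indexH : index_of (H n) @[n --> \oo] --> \oo)
    (ramH : forall n, ramanujan R (Schreier (H n) symS)) :
  (no_involution S -> freely_generated S) /\
  essentially_large_girth R (fun n => Schreier (H n) symS).
Proof.
split; last exact: Schreier_large_girth.
move=> noinv; apply: freely_generatedP => // u uS su uN.
exact: (reduced_prod_neq1 genS finH indexH ramH).
Qed.
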